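(* Let $M$ be a standard multigraph on $n$ vertices with $\delta(M)\geq\frac{4n-3}{3}$. Then $M$ has a tiling consisting of $\left\lfloor\frac{n}{3}\right\rfloor$ tiles, one of which is a $4$-triangle and the remaining $\left\lfloor\frac{n}{3}\right\rfloor-1$ of which are $5$-triangles.
   Context: Multigraphs have no loops. For vertices $x,y$ of a multigraph $M$, $\mu(x,y)$ denotes the number of edges with ends $x$ and $y$ (so $\mu(x,y)=0$ if $x,y$ are nonadjacent). $M$ is standard if $\mu(x,y)\le 2$ for all $x,y$. The degree of $x$ is $d(x)=\sum_{y}\mu(x,y)$ and $\delta(M)=\min_x d(x)$. For $k\in\{3,4,5,6\}$, a $k$-triangle is a multigraph on exactly three vertices that contains a (simple) triangle $C_3$ and has exactly $k$ edges (counted with multiplicity). A tiling of $M$ is a set of pairwise vertex-disjoint sub-multigraphs of $M$ (tiles); thus a tile that is a $k$-triangle exists on three vertices $x,y,z$ exactly when $x,y,z$ are pairwise adjacent and $\mu(x,y)+\mu(y,z)+\mu(x,z)\ge k$. *)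

(* Defs.v *)
From mathcomp Require Import all_boot.

Set Implicit Arguments.
Unset Strict Implicit.
Unset Printing Implicit Defensive.

(* A finite multigraph whose vertices lie in the ambient finite type T; a
   multigraph and its sub-multigraphs thus live in the same type.  The map
   [mult] gives the number of parallel edges on each set of ends; its support
   consists of pairs of distinct vertices, so there are no loops. *)
Record multigraph (T : finType) := Multigraph {
  vertices : {set T};
  mult : {set T} -> nat;
  multP : forall e : {set T}, 0 < mult e -> (#|e| == 2) && (e \subset vertices)
}.

Section Multigraph.

Variable T : finType.
Implicit Types (M H : multigraph T) (x y : T).

(* When x = y the set of ends is a singleton and mu M x x = 0. *)
Definition mu M x y : nat := mult M [set x; y].

Definition num_vertices M : nat := #|vertices M|.

Definition num_edges M : nat := \sum_(e : {set T}) mult M e.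

Definition standard M : Prop := forall x y, mu M x y <= 2.

Definition deg M x : nat := \sum_(y in vertices M) mu M x y.

(* The initial value of the iterated minimum is the maximum degree, which is
   neutral unless there are no vertices, in which case the result is 0. *)
Definition min_deg M : nat :=
  \big[minn / \max_(x in vertices M) deg M x]_(x in vertices M) deg M x.

Definition submultigraph H M : bool :=
  (vertices H \subset vertices M) && [forall e, mult H e <= mult M e].

(* The middle clause says that the three vertices span a simple triangle. *)
Definition ktriangle (k : nat) H : bool :=
  [&& num_vertices H == 3,
      [forall x in vertices H, forall y in vertices H,
         (x != y) ==> (0 < mu H x y)]
    & num_edges H == k].

Definition vertex_disjoint H1 H2 : bool :=
  [disjoint vertices H1 & vertices H2].

Definition tiling M (ts : seq (multigraph T)) : bool :=
  all (fun H => submultigraph H M) ts && pairwise vertex_disjoint ts.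

End Multigraph.

(* Main.v *)
(* Call an edge of multiplicity 2 double.  The cases n = 1, 2 mod 3 reduce to
   n = 3k by deleting a vertex, respectively adding a vertex joined to all others
   by double edges; then the minimum degree is at least 4k - 1.  Arguing by
   induction on the number of missing edges, M plus an edge is tiled, so M has
   k - 1 disjoint 5-triangles, or k - 2 of them and two further disjoint double
   edges.

   Everything rests on one averaging principle: if S is a family of vertices whose
   degrees into the triples L_1, ..., L_l of the current partition sum to less
   than |S|(4l - 1), then some other tile receives more than 4|S| edges from S.
   Exchanges on at most three triples at a time, checked by a verified branch and
   bound search over all multiplicities, improve the partition:
   - the second alternative above is reduced to the first one by increasing the
     number of 6-triangles;
   - a leftover triple becomes a path x - y - z with xy double;
   - such a path either gives the tiling with some tile vpq, or x, v, z are
     independent and almost completely joined by double edges to y, p, q.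
   In the last situation let I = xvz, K = ypq and let T be a tile with at least 13
   edges from I.  Then either I + K + T is tiled or, for some k in K, t in T and at
   least two i in I, the paths k - i - t can be left over and have small degree in
   I + K + T; a tile receiving more than 12 edges per path from these paths
   finishes the proof. *)

Require Import Defs.
From mathcomp Require Import all_boot all_order all_algebra.
From mathcomp Require Import zify.

Set Implicit Arguments.
Unset Strict Implicit.
Unset Printing Implicit Defensive.

Import GRing.Theory Num.Theory.

(** * Branch and bound over vectors of multiplicities *)

Section Search.

Implicit Types (w hi : seq nat) (g : seq (nat * nat)) (gs : seq (seq (nat * nat))).

Definition weigh (c w : seq nat) : nat := sumn [seq x.1 * x.2 | x <- zip c w].

(* A demand [(p, d)] asks for [d <= nth 0 w p]; a goal is a list of demands. *)
Definition meets w g : bool := all (fun x => x.2 <= nth 0 w x.1) g.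

Definition strip p d gs :=
  map (filter (fun x : nat * nat => ~~ (eqn x.1 p && (x.2 <= d)))) gs.

Definition prune p d gs :=
  filter (all (fun x : nat * nat => ~~ (eqn x.1 p && (d <= x.2)))) gs.

Definition shorter g1 g2 := if size g1 < size g2 then g1 else g2.

(* Branch and bound on the unmet demands of a shortest goal; [true] means that
   every [w <= hi] obeying the linear constraints [cs] meets some goal. *)
Fixpoint search fuel (cs : seq (seq nat * nat)) gs hi : bool :=
  if has (fun c => weigh c.1 hi < c.2) cs then true
  else if fuel is n.+1 then
    if gs is g0 :: _ then
      let fix branch g gs :=
        if g is x :: g' then
          search n cs (prune x.1 x.2 gs)
                 (set_nth 0 hi x.1 (minn x.2.-1 (nth 0 hi x.1)))
          && branch g' (strip x.1 x.2 gs)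
        else true in
      branch (foldr shorter g0 gs) gs
    else false
  else false.

Lemma weigh_le c w hi :
  (forall p, nth 0 w p <= nth 0 hi p) -> weigh c w <= weigh c hi.
Proof.
elim: c w hi => [|a c IH] [|x w] hi // le_w_hi.
suff: a * x + weigh c w <= a * nth 0 hi 0 + weigh c (behead hi).
  by case: hi {le_w_hi} => [|y hi]; rewrite /weigh // muln0; case: c {IH}.
apply: leq_add; first by rewrite leq_mul2l (le_w_hi 0) orbT.
by apply: IH => p; rewrite nth_behead; apply: (le_w_hi p.+1).
Qed.

Lemma mem_shorter g0 gs : foldr shorter g0 gs \in g0 :: gs.
Proof.
elim: gs => [|g gs IH] /=; first by rewrite inE.
rewrite /shorter; case: ifP => _; rewrite !inE ?eqxx ?orbT //.
by move: IH; rewrite inE => /orP[->|->]; rewrite ?orbT.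
Qed.

Lemma prune_sub p d gs : {subset prune p d gs <= gs}.
Proof. by move=> g; rewrite mem_filter => /andP[]. Qed.

Lemma has_strip w p d gs :
  d <= nth 0 w p -> has (meets w) (strip p d gs) -> has (meets w) gs.
Proof.
move=> le_d; rewrite has_map; apply: sub_has => g /=.
rewrite /meets all_filter; apply: sub_all => x /=.
case: (boolP (eqn _ _ && _)) => [/andP[/eqnP-> le_x] _|_ //].
exact: leq_trans le_x le_d.
Qed.

(** Follow the first demand [(p, d)] of the selected goal that [w] fails: the demands before it hold
    and are stripped, goals asking for at least [d] at [p] are pruned, and the upper bound at [p]
    drops to [d - 1]. If no demand fails, the goal is met. *)
Lemma search_sound fuel cs gs hi w :
    search fuel cs gs hi -> (forall p, nth 0 w p <= nth 0 hi p) ->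
    all (fun c => c.2 <= weigh c.1 w) cs ->
  has (meets w) gs.
Proof.
move=> + + cs_w; elim: fuel gs hi => [|n IH] gs hi /=; case: ifP => //.
- move=> /hasP[c c_cs lt_c] _ /(weigh_le c.1) le_c.
  by have := leq_trans (allP cs_w c c_cs) le_c; rewrite leqNgt lt_c.
- move=> /hasP[c c_cs lt_c] _ /(weigh_le c.1) le_c.
  by have := leq_trans (allP cs_w c c_cs) le_c; rewrite leqNgt lt_c.
move=> _; case Dgs: gs => [//|g0 gs']; rewrite -Dgs.
have: foldr shorter g0 gs \in gs.
  by have := mem_shorter g0 gs; rewrite Dgs !inE orbA orbb.
move: (foldr _ _ _) => g g_gs srch le_w.
have: meets w g || has (meets w) gs.
  move: srch; elim: g gs {Dgs g_gs} => //= -[p d] g IHg gs /andP[srch /IHg] /=.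
  have [le_d /orP[-> //|/(has_strip le_d) ->]|lt_d _] := leqP d (nth 0 w p).
    by rewrite orbT.
  have /hasP[h /prune_sub h_gs w_h] : has (meets w) (prune p d gs).
    apply: IH srch _ => q; rewrite nth_set_nth /=; case: eqP => // ->.
    by rewrite leq_min le_w andbT -ltnS prednK // (leq_ltn_trans _ lt_d).
  by apply/orP; right; apply/hasP; exists h.
by case/orP=> // w_g; apply/hasP; exists g.
Qed.

End Search.

(** * Triples of vertices, tile patterns and exchange plans *)

Definition trip (A : Type) : Type := (A * A * A)%type.

Definition vseq (A : Type) (ts : seq (trip A)) : seq A :=
  flatten [seq [:: t.1.1; t.1.2; t.2] | t <- ts].

Definition inst (A : Type) (x0 : A) (xs : seq A) (t : trip nat) : trip A :=
  (nth x0 xs t.1.1, nth x0 xs t.1.2, nth x0 xs t.2).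

(* The minimal multiplicities on [ab], [bc], [ac] that make [(a, b, c)] a tile
   of kind [k]: a [k]-triangle for [k = 4, 5, 6], a path with three edges for
   [k = 3], a double edge for [k = 2], anything for the other values. *)
Definition patterns (k : nat) : seq (trip nat) :=
  match k with
  | 6 => [:: (2, 2, 2)]
  | 5 => [:: (2, 2, 1); (2, 1, 2); (1, 2, 2)]
  | 4 => [:: (2, 1, 1); (1, 2, 1); (1, 1, 2)]
  | 3 => [:: (2, 1, 0); (2, 0, 1); (0, 2, 1); (1, 2, 0); (1, 0, 2); (0, 1, 2)]
  | 2 => [:: (2, 0, 0); (0, 2, 0); (0, 0, 2)]
  | _ => [:: (0, 0, 0)]
  end.

Definition tile (V : Type) (m : V -> V -> nat) (k : nat) (t : trip V) : bool :=
  has (fun q : trip nat =>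
    [&& q.1.1 <= m t.1.1 t.1.2, q.1.2 <= m t.1.2 t.2 & q.2 <= m t.1.1 t.2])
  (patterns k).

Definition wt (V : Type) (m : V -> V -> nat) (t : trip V) : nat :=
  m t.1.1 t.1.2 + m t.1.2 t.2 + m t.1.1 t.2.

Definition pairs (N : nat) : seq (nat * nat) :=
  [seq (i, j) | j <- rev (iota 0 N), i <- iota 0 j].

Definition code (N i j : nat) : nat := index (minn i j, maxn i j) (pairs N).

Definition demands N (t q : trip nat) : seq (nat * nat) :=
  [seq x <- [:: (code N t.1.1 t.1.2, q.1.1); (code N t.1.2 t.2, q.1.2);
                (code N t.1.1 t.2, q.2)] | 0 < x.2].

Definition plan : Type := seq (nat * trip nat).

Fixpoint plan_goals N (p : plan) : seq (seq (nat * nat)) :=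
  if p is (k, t) :: p' then
    [seq demands N t q ++ g | q <- patterns k, g <- plan_goals N p']
  else [:: [::]].

Definition plan_ok N (p : plan) : bool :=
  perm_eq (vseq (map snd p)) (iota 0 N).

Definition coefs N (ps : seq (nat * nat)) : seq nat :=
  [seq count_mem q ps | q <- pairs N].

(* [lbs] lists lower bounds on multiplicities; each member of [cs] is a lower
   bound on the total multiplicity of a list of pairs. *)
Definition always N fuel (cs : seq (seq (nat * nat) * nat))
    (lbs : seq (nat * nat * nat)) hi plans : bool :=
  [&& all (plan_ok N) plans, all (fun c => all (mem (pairs N)) c.1) cs &
    search fuel [seq (coefs N c.1, c.2) | c <- cs]
      (foldr (fun x => strip (code N x.1.1 x.1.2) x.2)
             (flatten (map (plan_goals N) plans)) lbs) hi].

Lemma all2_leq_nth (w hi : seq nat) :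
  all2 leq w hi -> forall p, nth 0 w p <= nth 0 hi p.
Proof.
elim: w hi => [|x w IH] [|y hi] // /andP[le_xy /IH{}IH] [|p] //=.
Qed.

Section Tiles.

Variables (V : eqType) (m : V -> V -> nat).
Hypotheses (mC : forall x y, m x y = m y x) (m_le2 : forall x y, m x y <= 2).
Implicit Types (t : trip V) (ts : seq (trip V)).

Lemma vseq_cat ts1 ts2 : vseq (ts1 ++ ts2) = vseq ts1 ++ vseq ts2.
Proof. by rewrite /vseq map_cat flatten_cat. Qed.

Lemma perm_vseq ts1 ts2 : perm_eq ts1 ts2 -> perm_eq (vseq ts1) (vseq ts2).
Proof. by move=> eq12; apply: perm_flatten; apply: perm_map. Qed.

Lemma size_vseq ts : size (vseq ts) = 3 * size ts.
Proof. by elim: ts => //= t ts ->; rewrite mulnS. Qed.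

Ltac mults := repeat match goal with |- context [m ?x ?y] =>
  have := m_le2 x y; move: (m x y) => [|[|[|?]]] // _ end.

(** Three multiplicities of at most 2 with sum at least 5 include at most one 1 and no 0, which is
    what the patterns list. *)
Lemma tile5E t : tile m 5 t = (5 <= wt m t).
Proof. case: t => -[a b] c; rewrite /tile /wt /=; mults. Qed.

Lemma tile4E t : tile m 4 t =
  [&& 4 <= wt m t, 0 < m t.1.1 t.1.2, 0 < m t.1.2 t.2 & 0 < m t.1.1 t.2].
Proof. case: t => -[a b] c; rewrite /tile /wt /=; mults. Qed.

Lemma tile6E t : tile m 6 t = (6 <= wt m t).
Proof. case: t => -[a b] c; rewrite /tile /wt /=; mults. Qed.

Lemma tile54 t : tile m 5 t -> tile m 4 t.
Proof. case: t => -[a b] c; rewrite /tile /=; mults. Qed.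

Lemma tile42 t : 4 <= wt m t -> tile m 2 t.
Proof. case: t => -[a b] c; rewrite /tile /wt /=; mults. Qed.

Section Plans.

Variables (N : nat) (x0 : V) (xs : seq V).

Definition weights : seq nat :=
  [seq m (nth x0 xs q.1) (nth x0 xs q.2) | q <- pairs N].

Lemma nth_weights i j : i < N -> j < N -> i != j ->
  nth 0 weights (code N i j) = m (nth x0 xs i) (nth x0 xs j).
Proof.
move=> lt_i lt_j ne_ij.
have mem_ij : (minn i j, maxn i j) \in pairs N.
  apply/allpairsPdep; exists (maxn i j), (minn i j); split=> //.
    by rewrite mem_rev mem_iota /=; lia.
  by rewrite mem_iota /=; lia.
rewrite (nth_map (0, 0)) ?index_mem // nth_index //=.
by case: ltnP => [_|_]; rewrite ?minnE ?maxnE //.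
Qed.

Lemma weights_le2 : all2 leq weights (nseq (size (pairs N)) 2).
Proof. by rewrite /weights; elim: (pairs N) => //= q s ->; rewrite m_le2. Qed.

Lemma weigh_coefs ps : all (mem (pairs N)) ps ->
  weigh (coefs N ps) weights = \sum_(q <- ps) m (nth x0 xs q.1) (nth x0 xs q.2).
Proof.
have uniq_pairs : uniq (pairs N).
  by apply: allpairs_uniq_dep => [|j _|[i j] [i' j'] _ _ [-> ->]] //;
    rewrite ?rev_uniq; apply: iota_uniq.
rewrite /weigh /coefs /weights.
have -> : forall s : seq (nat * nat),
    sumn [seq x.1 * x.2 | x <- zip [seq count_mem q ps | q <- s]
            [seq m (nth x0 xs q.1) (nth x0 xs q.2) | q <- s]] =
    \sum_(q <- s) count_mem q ps * m (nth x0 xs q.1) (nth x0 xs q.2).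
  by elim=> [|q s /= ->]; rewrite ?big_nil ?big_cons.
elim: ps => [_|p ps IH /= /andP[p_in /IH{}IH]].
  by rewrite big_nil big1 // => q _; rewrite mul0n.
rewrite big_cons -IH.
under eq_bigr => q _ do rewrite mulnDl.
rewrite big_split /= (bigD1_seq p) //= eqxx mul1n big1_seq ?addn0 // => q /andP[ne _].
by rewrite eq_sym (negPf ne).
Qed.

Lemma plan_goals_sound p :
    all (fun i => i < N) (vseq (map snd p)) -> uniq (vseq (map snd p)) ->
    has (meets weights) (plan_goals N p) ->
  all (fun x => tile m x.1 (inst x0 xs x.2)) p.
Proof.
elim: p => //= -[k [[a b] c]] p IH.
rewrite /vseq /= -/(vseq _) => /and4P[lt_a lt_b lt_c lt_p].
rewrite !inE !negb_or => /and4P[/and3P[ne_ab ne_ac _] /andP[ne_bc _] _ uniq_p].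
case/hasP=> _ /allpairsP[[q g] /= [q_k g_p ->]].
rewrite /meets all_cat => /andP[w_q w_g].
rewrite IH ?andbT //; last by apply/hasP; exists g.
apply/hasP; exists q => //=; move: w_q; rewrite /demands all_filter /=.
rewrite !nth_weights // andbT; case: q {q_k} => -[d1 d2] d3 /=.
by rewrite /implb; case: d1 d2 d3 => [|d1] [|d2] [|d3].
Qed.

Lemma alwaysP fuel cs lbs hi plans :
    always N fuel cs lbs hi plans -> all2 leq weights hi ->
    all (fun c => c.2 <= \sum_(q <- c.1) m (nth x0 xs q.1) (nth x0 xs q.2)) cs ->
    all (fun x => [&& x.1.1 < N, x.1.2 < N, x.1.1 != x.1.2
                    & x.2 <= m (nth x0 xs x.1.1) (nth x0 xs x.1.2)]) lbs ->
  exists2 p, p \in plans &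
    plan_ok N p /\ all (fun x => tile m x.1 (inst x0 xs x.2)) p.
Proof.
move=> /and3P[ok_plans ok_cs srch] le_hi w_cs w_lbs.
have {}w_cs : all (fun c => c.2 <= weigh c.1 weights)
                  [seq (coefs N c.1, c.2) | c <- cs].
  rewrite all_map; apply/allP=> c c_cs /=.
  by rewrite weigh_coefs ?(allP ok_cs) // (allP w_cs).
have {}le_hi := all2_leq_nth le_hi.
have: has (meets weights) (flatten (map (plan_goals N) plans)).
  (* The bounds [lbs] only erased demands that hold, so a goal met after stripping was met
     before. *)
  move: (search_sound srch le_hi w_cs); elim: lbs w_lbs {srch} => //= x lbs IH.
  case/andP=> /and4P[lt1 lt2 ne12 le_x] /IH{}IH w_str; apply: IH.
  by apply: has_strip w_str; rewrite nth_weights.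
case/hasP=> g /flatten_mapP[p p_plans g_p] w_g; exists p => //.
have ok_p := allP ok_plans p p_plans; split=> //.
apply: plan_goals_sound; last by apply/hasP; exists g.
  by apply/allP=> i; rewrite (perm_mem ok_p) mem_iota.
by rewrite (perm_uniq ok_p) iota_uniq.
Qed.

End Plans.

Lemma perm_plan ts x0 p : plan_ok (3 * size ts) p ->
  perm_eq (vseq (map (fun x => inst x0 (vseq ts) x.2) p)) (vseq ts).
Proof.
rewrite /plan_ok -size_vseq => ok_p.
have -> : vseq (map (fun x => inst x0 (vseq ts) x.2) p) =
          map (nth x0 (vseq ts)) (vseq (map snd p)).
  by rewrite /vseq map_flatten -!map_comp; congr flatten; apply: eq_map.
rewrite -[X in perm_eq _ X](mkseq_nth x0) /mkseq.
exact: perm_map.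
Qed.

End Tiles.

(** * Verified exchanges on two or three triples *)

Definition splits : seq (trip nat * trip nat) :=
  [:: ((0,1,2),(3,4,5)); ((0,1,3),(2,4,5)); ((0,1,4),(2,3,5));
      ((0,1,5),(2,3,4)); ((0,2,3),(1,4,5)); ((0,2,4),(1,3,5));
      ((0,2,5),(1,3,4)); ((0,3,4),(1,2,5)); ((0,3,5),(1,2,4));
      ((0,4,5),(1,2,3))].

Definition split_plans k l : seq plan :=
  flatten [seq [:: [:: (k, s.1); (l, s.2)]; [:: (k, s.2); (l, s.1)]]
          | s <- splits].

Definition grid (ps qs : seq nat) : seq (nat * nat) :=
  [seq (p, q) | p <- ps, q <- qs].

Definition tri : seq (nat * nat) := [:: (3, 4); (4, 5); (3, 5)].
Definition cross : seq (nat * nat) := grid (iota 0 3) (iota 3 3).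
Definition full N := nseq (size (pairs N)) 2.

(** Here and in [always_solved], 012 is left over and 345 is a tile; 13 stands for more than the 4 *
    3 edges of the averaging principle. *)
Lemma always_path :
  always 6 100 [:: (tri, 5); (cross, 13)] [::] (full 6)
    (split_plans 4 5 ++ split_plans 3 5).
Proof. by vm_compute. Qed.

(** The last three constraints exclude a vertex [t] of the tile such that 0, [t], 2 are
    independent. *)
Lemma always_solved :
  always 6 100 ([:: (tri, 5); (cross, 13)] ++
                [seq ([:: (0, 2); (0, t); (2, t)], 1) | t <- iota 3 3])
    [:: (0, 1, 1); (1, 2, 1)] (full 6) (split_plans 4 5).
Proof. by vm_compute. Qed.

(** The threshold complements the averaging condition: up to 20 edges inside six vertices, the
    degree sum is at most 40 < 6 * 7. *)
Lemma always_five :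
  always 6 100 [:: (pairs 6, 21)] [:: (0, 1, 2); (3, 4, 2)] (full 6)
    (split_plans 0 5).
Proof. by vm_compute. Qed.

(** Vertices 0, 1, 2 are i, j, k and 3, 4, 5 are w, p, q in [transfer_solved]; 9 is 13 minus the at
    most four edges from t to p and q. *)
Lemma always_final :
  always 6 100 [:: (tri, 5); ([:: (0, 3); (0, 4); (0, 5); (2, 4); (2, 5)], 9);
                  ([:: (1, 4); (1, 5)], 1); ([:: (1, 3); (1, 4); (1, 5)], 3)]
    [:: (0, 2, 1); (1, 2, 1)] (full 6) (split_plans 4 5).
Proof. by vm_compute. Qed.

Definition minus (s r : seq nat) : seq nat := [seq i <- s | i \notin r].
Definition tr (s : seq nat) : trip nat := (nth 0 s 0, nth 0 s 1, nth 0 s 2).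

(* Vertices 0 to 5 are left over, 01 and 34 are double edges, 678 is a tile. *)
Definition plans_gain : seq plan :=
  let T := [:: 6; 7; 8] in
  flatten [seq
    [seq [:: (0, tr (minus (iota 0 6) [:: x; q.1.1; q.1.2]));
             (5, tr (x :: minus T [:: q.2])); (5, (q.2, q.1.1, q.1.2))]
    | x <- minus (iota 0 6) [:: q.1.1; q.1.2]]
  | q <- [seq (d, s) | d <- [:: (0, 1); (3, 4)], s <- T]] ++
  [seq [:: (0, tr [:: 2, 5 & minus T [:: s.1; s.2]]);
           (5, (0, 1, s.1)); (5, (3, 4, s.2))]
  | s <- [:: (6, 7); (6, 8); (7, 6); (7, 8); (8, 6); (8, 7)]].

(** The 6-triangle consists of two vertices of T with 2 or 5, of two vertices of T with an end of a
    double edge, or of a double edge with one vertex of T. *)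
Definition plans_heavier : seq plan :=
  let T := [:: 6; 7; 8] in
  flatten [seq
    [seq [:: (2, (0, 1, s)); (2, (3, 4, c.2)); (6, tr (c.1 :: minus T [:: s]))]
    | c <- [:: (2, 5); (5, 2)]] ++
    flatten [seq
      [seq [:: (2, tr (q.1.2 :: x.1)); (2, tr (x.2 :: q.2));
               (6, tr (q.1.1 :: minus T [:: s]))]
      | x <- [:: ([:: s; 2], 5); ([:: s; 5], 2); ([:: 2; 5], s)]]
    | q <- [:: (0, 1, [:: 3; 4]); (1, 0, [:: 3; 4]);
               (3, 4, [:: 0; 1]); (4, 3, [:: 0; 1])]] ++
    [seq [:: (2, tr (x :: d.2)); (2, tr (minus ([:: 2; 5] ++ minus T [:: s]) [:: x]));
             (6, tr (s :: d.1))]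
    | d <- [:: ([:: 0; 1], [:: 3; 4]); ([:: 3; 4], [:: 0; 1])],
      x <- [:: 2; 5] ++ minus T [:: s]]
  | s <- T].

Definition tile_cross : seq (nat * nat) := grid (iota 0 6) (iota 6 3).

(** Capping the edge 68 at 1 says that the tile is not a 6-triangle, so that building a 6-triangle
    is progress. For a tile that is one already, [always_gain] has to produce two 5-triangles. *)
Lemma always_gain_or_heavier :
  always 9 100 [:: (tile_cross, 25)]
    [:: (0, 1, 2); (3, 4, 2); (6, 7, 2); (7, 8, 2); (6, 8, 1)]
    (set_nth 0 (full 9) (code 9 6 8) 1) (plans_gain ++ plans_heavier).
Proof. by vm_compute. Qed.

Lemma always_gain :
  always 9 100 [:: (tile_cross, 25)]
    [:: (0, 1, 2); (3, 4, 2); (6, 7, 2); (7, 8, 2); (6, 8, 2)]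
    (full 9) plans_gain.
Proof. by vm_compute. Qed.

(** * Exhaustive computation for the last exchange, on I, K and T *)

Fixpoint words (vs : seq nat) (n : nat) : seq (seq nat) :=
  if n is n'.+1 then [seq v :: s | v <- vs, s <- words vs n'] else [:: [::]].

Lemma mem_words vs n s : size s = n -> all (mem vs) s -> s \in words vs n.
Proof.
elim: n s => [|n IH] [|v s] //= [sz_s] /andP[v_vs s_vs].
by apply: allpairs_f; rewrite ?IH.
Qed.

Definition nxt (i : nat) : nat := nth 0 [:: 1; 2; 0] i.
Definition prv (i : nat) : nat := nth 0 [:: 2; 0; 1] i.

(* Three triples I (independent), K and T, where T is a tile whose only possibly
   simple edge joins the vertices 1 and 2.  The word [b] lists the nine
   multiplicities between I and K, then the edges of K (each one indexed by the
   opposite vertex); the word [a] lists the multiplicities between I and T. *)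
Definition ik (b : seq nat) i k : nat := nth 0 b (3 * i + k).
Definition kk (b : seq nat) k : nat := nth 0 b (9 + k).

Definition ktile b k i : bool :=
  5 <= ik b i (nxt k) + ik b i (prv k) + kk b k.
(** The constants bound from below the edge of T opposite to [t]; only the one opposite to 0 may be
    simple. *)
Definition ttile a t i : bool :=
  5 <= ik a i (nxt t) + ik a i (prv t) + (if t is 0 then 1 else 2).

Definition info := seq (seq nat * seq bool).

(** Tabulated once per word, because every pair of words is examined afterwards. *)
Definition info_of (tilep : nat -> nat -> bool) (b : seq nat) : info :=
  [seq ([seq ik b i k | i <- iota 0 3], [seq tilep k i | i <- iota 0 3])
  | k <- iota 0 3].

Section Selection.

Variables KI TI : info.

Definition mk i k : nat := nth 0 (nth ([::], [::]) KI k).1 i.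
Definition mt i t : nat := nth 0 (nth ([::], [::]) TI t).1 i.
Definition tk k i : bool := nth false (nth ([::], [::]) KI k).2 i.
Definition tt k i : bool := nth false (nth ([::], [::]) TI k).2 i.

(* [center k t i]: the path [k - i - t] is left over by two tiles of I, K, T. *)
Definition center k t i : bool :=
  if mt i t is 0 then false else
  if (if tk k (nxt i) then tt t (prv i) else false) then true
  else if tk k (prv i) then tt t (nxt i) else false.

(* A bound for the multiplicity between [k] and [t] when no solution contains
   a triangle with one vertex in each of I, K and T. *)
Definition cap k t : nat :=
  foldr (fun i c => if center k t i then minn (3 - (mk i k + mt i t)) c else c) 2
        (iota 0 3).

End Selection.

Definition rows (b : seq nat) : seq nat :=
  [seq sumn [seq ik b i k | k <- iota 0 3] | i <- iota 0 3].

Definition degK (b : seq nat) : seq nat :=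
  [seq kk b (nxt k) + kk b (prv k) + sumn [seq ik b i k | i <- iota 0 3]
  | k <- iota 0 3].

(* The degrees of [i], [k], [t] in I + K + T sum to less than 33 on average. *)
Definition good (KI TI : info) (rowsK rowsT dK : seq nat) k t : bool :=
  let c := filter (center KI TI k t) (iota 0 3) in
  if 1 < size c then
    sumn (map (fun i => nth 0 rowsK i + nth 0 rowsT i) c) + size c *
      (nth 0 dK k + sumn (map (cap KI TI k) (iota 0 3)) +
       (4 + sumn (map (fun i => mt TI i t) (iota 0 3)) +
        sumn (map ((cap KI TI)^~ t) (iota 0 3)))) < 33 * size c
  else false.

(** Each vertex of I has to form a tile with K minus [k], because the final transfer does not
    control which of them goes there. Using [find] and [if] lets call-by-value evaluation stop at
    the first witness. *)
Definition some_good (a b : info * seq nat * seq nat) : bool :=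
  let ok k t := if all (tk b.1.1 k) (iota 0 3)
                then good b.1.1 a.1.1 b.1.2 a.1.2 b.2 k t else false in
  find (fun k => find (ok k) (iota 0 3) < 3) (iota 0 3) < 3.

Definition ik_data (b : seq nat) := (info_of (ktile b) b, rows b, degK b).
Definition it_data (a : seq nat) := (info_of (ttile a) a, rows a, [::] : seq nat).

(* The order is x, v, z for I and y, p, q for K, where x - y - z is a path left
   over by a tiling and vpq is a tile. *)
Definition ik_words : seq (seq nat) :=
  [seq b <- words [:: 1; 2] 12 |
    let w := nth 0 b in
    [&& w 0 == 2, 5 <= w 4 + w 5 + w 9, w 5 <= w 4
      & 13 <= w 1 + w 2 + w 3 + w 7 + w 8 + w 10 + w 11]].

(** The last comparison breaks the symmetry between the vertices 1 and 2 of T. *)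
Definition it_words : seq (seq nat) :=
  [seq a <- words [:: 0; 1; 2] 9 |
    let w := nth 0 a in
    if 13 <= sumn a then w 2 + w 5 + w 8 <= w 1 + w 4 + w 7 else false].

Lemma always_good :
  all (fun a => all (some_good a) (map ik_data ik_words)) (map it_data it_words).
Proof. by vm_compute. Qed.

(** * Edge counts, partitions into triples and the averaging principle *)

Definition esum (V : eqType) (m : V -> V -> nat) (S R : seq V) : nat :=
  \sum_(x <- S) \sum_(y <- R) m x y.

Definition part (V : finType) (ts : seq (trip V)) : bool :=
  perm_eq (vseq ts) (enum V).

Definition solved (V : finType) (m : V -> V -> nat) : Prop :=
  exists t ts, [/\ part (t :: ts), tile m 4 t & all (tile m 5) ts].

Section Core.

Variables (V : finType) (m : V -> V -> nat).
Hypotheses (mC : forall x y, m x y = m y x) (mxx : forall x, m x x = 0).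
Hypothesis m_le2 : forall x y, m x y <= 2.
Implicit Types (L T : trip V) (ts Ls rest : seq (trip V)) (S R : seq V).

Lemma esum_perm S S' R R' :
  perm_eq S S' -> perm_eq R R' -> esum m S R = esum m S' R'.
Proof.
move=> eqS eqR; rewrite /esum (perm_big _ eqS) /=.
by apply: eq_bigr => x _; apply: perm_big.
Qed.

Lemma esum_catl S S' R : esum m (S ++ S') R = esum m S R + esum m S' R.
Proof. by rewrite /esum big_cat. Qed.

Lemma esum_catr S R R' : esum m S (R ++ R') = esum m S R + esum m S R'.
Proof. by rewrite /esum -big_split; apply: eq_bigr => x _; rewrite big_cat. Qed.

Lemma wt_esum t : (wt m t).*2 = esum m (vseq [:: t]) (vseq [:: t]).
Proof.
case: t => -[a b] c; rewrite /esum /vseq /wt /= !big_cons !big_nil !mxx.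
by rewrite (mC b a) (mC c a) (mC c b); lia.
Qed.

Lemma perm_tile5 t t' : perm_eq (vseq [:: t]) (vseq [:: t']) ->
  tile m 5 t = tile m 5 t'.
Proof.
move=> eq_t; rewrite !tile5E //; congr (_ <= _); apply: double_inj.
by rewrite !wt_esum; apply: esum_perm.
Qed.

Lemma perm_part ts ts' : perm_eq (vseq ts) (vseq ts') -> part ts = part ts'.
Proof. by move=> eq_ts; rewrite /part (permPl eq_ts). Qed.

Lemma part_plan x0 Ls rest p : plan_ok (3 * size Ls) p ->
    all (fun x => tile m x.1 (inst x0 (vseq Ls) x.2)) p -> part (Ls ++ rest) ->
  exists2 ts, part (ts ++ rest) & all2 (tile m) (unzip1 p) ts.
Proof.
move=> ok_p tiles_p part_L; exists [seq inst x0 (vseq Ls) x.2 | x <- p].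
  rewrite (perm_part (ts' := Ls ++ rest)) // !vseq_cat perm_cat2r.
  exact: perm_plan.
by elim: p tiles_p {ok_p} => //= -[i t] p IH /andP[-> /IH].
Qed.

(** Applies a verified exchange inside a partition: the triples [Ls] are rearranged, [rest] stays,
    and only the kinds of the new tiles are remembered. *)
Lemma always_part N fuel cs lbs hi plans (kinds : seq (seq nat)) x0 Ls rest :
    always N fuel cs lbs hi plans -> all (fun p => unzip1 p \in kinds) plans ->
    N = 3 * size Ls -> part (Ls ++ rest) ->
    all2 leq (weights m N x0 (vseq Ls)) hi ->
    all (fun c => c.2 <=
           \sum_(q <- c.1) m (nth x0 (vseq Ls) q.1) (nth x0 (vseq Ls) q.2)) cs ->
    all (fun x => [&& x.1.1 < N, x.1.2 < N, x.1.1 != x.1.2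
           & x.2 <= m (nth x0 (vseq Ls) x.1.1) (nth x0 (vseq Ls) x.1.2)]) lbs ->
  exists2 ts, part (ts ++ rest) & has (fun ks => all2 (tile m) ks ts) kinds.
Proof.
move=> alw kinds_p DN part_L le_hi w_cs w_lbs.
have [p p_in [ok_p tiles_p]] := alwaysP mC alw le_hi w_cs w_lbs.
have [|ts part_ts tiles_ts] := part_plan (x0 := x0) _ tiles_p part_L.
  by rewrite -DN.
by exists ts => //; apply/hasP; exists (unzip1 p); rewrite ?(allP kinds_p).
Qed.

Lemma kinds2 i j ts : all2 (tile m) [:: i; j] ts ->
  exists t u, [/\ ts = [:: t; u], tile m i t & tile m j u].
Proof.
case: ts => [|t [|u [|? ?]]]; rewrite /= ?andbF ?andbT // => /andP[].
by exists t, u.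
Qed.

Lemma kinds3 i j l ts : all2 (tile m) [:: i; j; l] ts ->
  exists t u v, [/\ ts = [:: t; u; v], tile m i t, tile m j u & tile m l v].
Proof.
case: ts => [|t [|u [|v [|? ?]]]]; rewrite /= ?andbF ?andbT // => /and3P[].
by exists t, u, v.
Qed.

Lemma part_perm1 Ls T T' rest : perm_eq (vseq [:: T]) (vseq [:: T']) ->
  part (Ls ++ T :: rest) = part (Ls ++ T' :: rest).
Proof.
move=> eqT; apply: perm_part.
by rewrite -(cat1s T) -(cat1s T') !vseq_cat perm_cat2l perm_cat2r.
Qed.

Ltac perm3 := by apply/permP=> ? /=; lia.

Lemma double_first T : tile m 2 T -> exists a b c,
  perm_eq (vseq [:: T]) (vseq [:: (a, b, c)]) /\ 2 <= m a b.
Proof.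
case: T => -[a b] c; rewrite /tile /= !andbT orbF => /or3P[] mab.
- by exists a, b, c.
- by exists b, c, a; split=> //; perm3.
- by exists a, c, b; split=> //; perm3.
Qed.

Lemma five_order T : tile m 5 T -> exists a b c,
  [/\ perm_eq (vseq [:: T]) (vseq [:: (a, b, c)]), 2 <= m a b, 2 <= m b c
    & 1 <= m a c].
Proof.
case: T => -[a b] c; rewrite /tile /= orbF => /or3P[] /and3P[m1 m2 m3].
- by exists a, b, c.
- by exists b, a, c; split=> //; [perm3 | rewrite mC].
- by exists a, c, b; split=> //; [perm3 | rewrite mC].
Qed.

Variable nt : nat.
Hypotheses (cardV : #|V| = 3 * nt).
Hypothesis deg_ge : forall x, 4 * nt <= (\sum_y m x y).+1.

(** Otherwise each triple of [rest] takes at most 4|S| edges, and the degrees over [S] sum to less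
    than |S|(4 nt - 1). Repetitions in [S] are allowed and count with multiplicity. *)
Lemma exists_tile S Ls rest :
    part (Ls ++ rest) -> esum m S (vseq Ls) < size S * (4 * size Ls).-1 ->
  exists T rest', [/\ perm_eq rest (T :: rest'),
    part ((Ls ++ [:: T]) ++ rest') & 4 * size S < esum m S (vseq [:: T])].
Proof.
move=> part_Lr lt_e.
have [/hasP[T T_rest lt_T]|no_T] :=
    boolP (has (fun T => 4 * size S < esum m S (vseq [:: T])) rest).
  exists T, (rem T rest); have eq_r := perm_to_rem T_rest; split=> //.
  rewrite -(perm_part (ts := Ls ++ rest)) // -catA !vseq_cat perm_cat2l.
  by rewrite -vseq_cat; apply: perm_vseq.
exfalso; have size_k : size Ls + size rest = nt.
  have := perm_size part_Lr; rewrite size_vseq size_cat -cardE cardV.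
  by move/eqP; rewrite eqn_pmul2l // => /eqP.
have le_rest : esum m S (vseq rest) <= size rest * (4 * size S).
  elim: rest no_T {part_Lr size_k} => [_|T ts IH /=].
    by rewrite /esum big1 // => x _; rewrite big_nil.
  rewrite negb_or -leqNgt => /andP[le_T /IH le_ts].
  by rewrite -cat1s vseq_cat esum_catr mulSn leq_add.
have: size S * (4 * nt).-1 <= esum m S (vseq (Ls ++ rest)).
  rewrite /esum -sum1_size big_distrl /= leq_sum // => x _.
  rewrite (perm_big _ part_Lr) big_enum /= mul1n.
  by have := deg_ge x; case: (4 * nt).
by rewrite vseq_cat esum_catr -size_k; case: (Ls) lt_e => [|? ?] /=; nia.
Qed.

Lemma to_path L ts : part (L :: ts) -> all (tile m 5) ts ->
  solved m \/ exists L' ts', [/\ part (L' :: ts'), tile m 3 L' & all (tile m 5) ts'].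
Proof.
move=> part_L ts5; have [L3|nL3] := boolP (tile m 3 L).
  by right; exists L, ts.
(* Weight 4 forces a double edge and a second edge, hence a path of kind 3. *)
have wtL : wt m L <= 3.
  move: nL3; case: (L) => -[a b] c; rewrite /tile /wt /=.
  by have := m_le2 a b; have := m_le2 b c; have := m_le2 a c;
    move: (m a b) (m b c) (m a c) => [|[|[|?]]] [|[|[|?]]] [|[|[|?]]].
(* The degrees inside [L] sum to at most 6 < 3 * 3. *)
have /(exists_tile (Ls := [:: L])) := part_L.
move=> /(_ (vseq [:: L])) /(_ _)[|T [rest [eq_ts part_LT lt13]]].
  by rewrite -wt_esum size_vseq /=; lia.
have /andP[T5 rest5] : all (tile m 5) (T :: rest) by rewrite -(perm_all _ eq_ts).
have [|ts' part_ts] := always_part (x0 := L.2) (Ls := [:: L; T])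
    (kinds := [:: [:: 4; 5]; [:: 3; 5]]) always_path isT erefl part_LT
    (weights_le2 m_le2 _ _ _) _ isT.
  move: T5 lt13; rewrite tile5E // size_vseq /esum /wt.
  case: (L) (T) => -[a b] c [[d f] g].
  rewrite /vseq /cross /tri /grid /= !big_cons !big_nil /=.
  lia.
case/hasP=> ks; rewrite !inE => /orP[] /eqP-> /kinds2[t [u [Dts tile_t tile_u]]];
  rewrite {}Dts in part_ts.
  by left; exists t, (u :: rest); rewrite /= tile_u.
by right; exists t, (u :: rest); rewrite /= tile_u.
Qed.


(** Induction on the number of tiles that are not 6-triangles. If [A] and [B] together contain no
    5-triangle, a tile receiving more than 24 edges from them yields two 5-triangles, or a new
    6-triangle and again two triples with double edges. *)
Lemma doubles_to_leftover A B ts :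
    part (A :: B :: ts) -> tile m 2 A -> tile m 2 B -> all (tile m 5) ts ->
  exists L ts', part (L :: ts') /\ all (tile m 5) ts'.
Proof.
have [n] := ubnP (count (predC (tile m 6)) ts).
elim: n A B ts => // n IH A0 B0 ts lt_n part0 /double_first[a [b [c [eqA mab]]]]
  /double_first[d [f [g [eqB mdf]]]] ts5.
pose A := (a, b, c); pose B := (d, f, g).
have {A0 B0 eqA eqB part0} part_AB : part (A :: B :: ts).
  move: part0; rewrite -[A0 :: _]cat0s (part_perm1 _ _ eqA).
  by rewrite -[_ ++ _]/([:: A] ++ B0 :: ts) (part_perm1 _ _ eqB).
have [ge21|lt21] := leqP 21 (\sum_(q <- pairs 6)
    m (nth a (vseq [:: A; B]) q.1) (nth a (vseq [:: A; B]) q.2)).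
  have [||ts' part_ts] := always_part (x0 := a) (Ls := [:: A; B])
    (kinds := [:: [:: 0; 5]]) always_five isT erefl part_AB
    (weights_le2 m_le2 _ _ _).
  - by rewrite /= ge21.
  - by rewrite /= mab mdf.
  rewrite has_seq1 => /kinds2[t [u [Dts _ u5]]]; rewrite {}Dts in part_ts.
  by exists t, (u :: ts); rewrite /= u5.
have /(exists_tile (Ls := [:: A; B]) (S := vseq [:: A; B])) := part_AB.
case=> [|T [rest [eq_ts part_T lt24]]].
  move: lt21; rewrite /esum /vseq /= !big_cons !big_nil /= !mxx.
  rewrite (mC b a) (mC c a) (mC d a) (mC f a) (mC g a) (mC c b) (mC d b) (mC f b).
  rewrite (mC g b) (mC d c) (mC f c) (mC g c) (mC f d) (mC g d) (mC g f).
  lia.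
have /andP[T5 rest5] : all (tile m 5) (T :: rest) by rewrite -(perm_all _ eq_ts).
have {}lt_n : ~~ tile m 6 T + count (predC (tile m 6)) rest < n.+1.
  by move: lt_n; rewrite (permP eq_ts).
have [x [y [z [eqT mxy myz mxz]]]] := five_order T5.
have {part_T} part_T : part ([:: A; B; (x, y, z)] ++ rest).
  by rewrite -[_ ++ _]/([:: A; B] ++ (x, y, z) :: rest) -(part_perm1 _ _ eqT).
have {}lt24 : 24 < esum m (vseq [:: A; B]) (vseq [:: (x, y, z)]).
  by rewrite -(esum_perm (perm_refl _) eqT).
have gain ts' : part (ts' ++ rest) -> all2 (tile m) [:: 0; 5; 5] ts' ->
    exists L ts', part (L :: ts') /\ all (tile m 5) ts'.
  move=> part_ts /kinds3[t [u [v [Dts _ u5 v5]]]]; rewrite {}Dts in part_ts.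
  by exists t, [:: u, v & rest]; rewrite /= u5 v5.
have [T6|nT6] := boolP (tile m 6 T).
  have mxz2 : 2 <= m x z.
    move: T6; rewrite tile6E // -leq_double wt_esum (esum_perm eqT eqT) -wt_esum.
    by have := m_le2 x y; have := m_le2 y z; rewrite /wt /=; lia.
  have [||ts' part_ts] := always_part (x0 := a) (Ls := [:: A; B; (x, y, z)])
    (kinds := [:: [:: 0; 5; 5]]) always_gain isT erefl part_T
    (weights_le2 m_le2 _ _ _).
  - move: lt24; rewrite /esum /vseq /tile_cross /grid /= !big_cons !big_nil /=; lia.
  - by rewrite /= mab mdf mxy myz mxz2.
  by rewrite has_seq1 => /gain; apply.
(* The ordering of the tile leaves [x z] as its only edge that can be simple. *)
have mxz1 : m x z <= 1.
  move: nT6; rewrite tile6E // -leq_double wt_esum (esum_perm eqT eqT) -wt_esum.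
  by rewrite /wt /=; lia.
have [|||ts' part_ts] := always_part (x0 := a) (Ls := [:: A; B; (x, y, z)])
    (kinds := [:: [:: 0; 5; 5]; [:: 2; 2; 6]]) always_gain_or_heavier isT erefl part_T.
- by rewrite /weights /= !m_le2 mxz1.
- move: lt24; rewrite /esum /vseq /tile_cross /grid /= !big_cons !big_nil /=; lia.
- by rewrite /= mab mdf mxy myz mxz.
case/orP=> [/gain|]; first exact.
rewrite orbF => /kinds3[t [u [v [Dts t2 u2 v6]]]]; rewrite {}Dts in part_ts.
apply: IH part_ts t2 u2 _ => /=.
  by move: lt_n; rewrite v6 nT6.
by apply/andP; split=> //; move: v6; rewrite tile5E // tile6E //; apply: ltnW.
Qed.

(** * Rearrangements and exchanges around a path left over *)

Lemma perm_transversal (A : eqType) (a0 a1 a2 b0 b1 b2 c0 c1 c2 : A) (sa sb sc : seq A) :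
    perm_eq [:: a0; a1; a2] sa -> perm_eq [:: b0; b1; b2] sb ->
    perm_eq [:: c0; c1; c2] sc ->
  perm_eq [:: b0; a0; c0; a1; b1; b2; a2; c1; c2] (sa ++ sb ++ sc).
Proof.
move=> pa pb pc.
rewrite -(permPr (perm_cat pa (perm_cat pb pc))); apply/permP=> P /=.
move: (P a0 : nat) (P a1 : nat) (P a2 : nat) (P b0 : nat) (P b1 : nat) (P b2 : nat).
by move: (P c0 : nat) (P c1 : nat) (P c2 : nat) => *; lia.
Qed.

Lemma esum_flatten (ss : seq (seq V)) R :
  esum m (flatten ss) R = \sum_(S <- ss) esum m S R.
Proof.
elim: ss => [|S ss IH]; first by rewrite /esum !big_nil.
by rewrite big_cons -IH; apply: esum_catl.
Qed.

Lemma perm_final (A : eqType) (a0 a1 a2 b0 b1 b2 : A) (sa sb sc sd se sf : seq A) :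
    perm_eq [:: a0; a1; a2] sa -> perm_eq [:: b0; b1; b2] sb -> perm_eq sd se ->
  perm_eq ([:: a0; a1; b0] ++ sd ++ [:: a2; b1; b2] ++ sc ++ sf)
          ((((sa ++ sb) ++ sc) ++ se) ++ sf).
Proof.
move=> pa pb pd; rewrite !catA perm_cat2r -!catA.
rewrite -(permPr (perm_cat pa (perm_cat pb (perm_cat (perm_refl sc) pd)))).
apply/permP=> P; rewrite /= !count_cat /= ?count_cat /=.
move: (P a0 : nat) (P a1 : nat) (P a2 : nat) (P b0 : nat) (P b1 : nat) (P b2 : nat).
by lia.
Qed.

Lemma perm_insert (A : eqType) (c d e t : A) (s s' : seq A) :
  perm_eq s (t :: s') -> perm_eq ([:: c; d; e] ++ s) ([:: c; t] ++ [:: d, e & s']).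
Proof.
move=> eq_s; rewrite /= perm_cons.
apply: perm_trans (_ : perm_eq [:: d, e, t & s'] _); first by rewrite !perm_cons.
by rewrite (perm_catCA [:: d; e] [:: t] s').
Qed.

Lemma perm_tail (A : eqType) (c d e : A) : perm_eq [:: c; d; e] [:: c; e; d].
Proof. by apply/permP=> P /=; lia. Qed.

Lemma perm_head (A : eqType) (c d e : A) : perm_eq [:: c; d; e] [:: d; c; e].
Proof. by apply/permP=> P /=; lia. Qed.

Lemma perm_middle (A : eqType) (c d e f g h : A) :
  perm_eq [:: c; d; e; f; g; h] [:: c; f; e; d; g; h].
Proof.
apply/permP=> P /=; move: (P c : nat) (P d : nat) (P e : nat) (P f : nat).
by move: (P g : nat) (P h : nat); lia.
Qed.

Lemma connected_solved x y z T rest :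
    part ([:: (x, y, z); T] ++ rest) -> 1 <= m x y -> 1 <= m y z -> tile m 5 T ->
    12 < esum m [:: x; y; z] (vseq [:: T]) ->
    {in vseq [:: T], forall v, m x z + m x v + m z v != 0} ->
  exists t u, [/\ part (t :: u :: rest), tile m 4 t & tile m 5 u].
Proof.
move=> part_T xy yz T5 lt12 ok_T.
have [||ts part_ts] := always_part (x0 := x) (kinds := [:: [:: 4; 5]])
    (Ls := [:: (x, y, z); T])
    always_solved isT erefl part_T (weights_le2 m_le2 _ _ _).
- case: T T5 lt12 ok_T {part_T} => -[d f] g; rewrite tile5E // /esum /wt.
  rewrite /vseq /cross /tri /grid /= !big_cons !big_nil /= => T5 lt12 ok_T.
  have := ok_T d; have := ok_T f; have := ok_T g.
  rewrite !inE !eqxx ?orbT -!lt0n => /(_ isT) ? /(_ isT) ? /(_ isT) ?; lia.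
- by rewrite /= xy yz.
rewrite has_seq1 => /kinds2[t [u [Dts t4 u5]]]; rewrite {}Dts in part_ts.
by exists t, u.
Qed.

(** Serves when [k], [t], [w] are independent and block the path k - i - t: the path i - k - j is
    left over in its place, and [t] returns to its former tile. *)
Lemma transfer_solved i j k t w p q rest :
    part ([:: (i, j, k); (w, p, q)] ++ rest) -> tile m 5 (w, p, q) ->
    1 <= m i k -> 1 <= m j k -> m k w = 0 -> m t w = 0 ->
    12 < esum m [:: k; i; t] [:: w; p; q] -> 3 <= m j w + m j p + m j q ->
  exists t4 t5, [/\ part (t4 :: t5 :: rest), tile m 4 t4 & tile m 5 t5].
Proof.
move=> part_T T5 ik jk kw tw lt12 ge3.
have [||ts part_ts] := always_part (x0 := i) (kinds := [:: [:: 4; 5]])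
    (Ls := [:: (i, j, k); (w, p, q)])
    always_final isT erefl part_T (weights_le2 m_le2 _ _ _).
- move: T5 lt12; rewrite tile5E // /wt /vseq /tri /esum /= !big_cons !big_nil /=.
  rewrite kw tw => T5 lt12.
  have := m_le2 j w; have := m_le2 t p; have := m_le2 t q; lia.
- by rewrite /= ik jk.
rewrite has_seq1 => /kinds2[t4 [t5 [Dts t4P t5P]]]; rewrite {}Dts in part_ts.
by exists t4, t5.
Qed.

(** A path k - l - t sends at most 8 edges plus those of [I l]. If every centre other than [i] sent
    at most 2, the total would be at most 14 + 10(|c| - 1), which is at most 12|c| as |c| is at
    least 2. *)
Lemma exists_transfer (I : nat -> V) k t (c : seq nat) i w p q :
    uniq c -> 1 < size c -> i \in c -> m k w = 0 -> m t w = 0 ->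
    12 * size c < \sum_(l <- c) esum m [:: k; I l; t] [:: w; p; q] ->
  exists2 j, j \in c & (i != j) && (3 <= m (I j) w + m (I j) p + m (I j) q).
Proof.
move=> c_uniq gt1_c i_c kw tw.
pose r l := m (I l) w + m (I l) p + m (I l) q.
have le8 l : esum m [:: k; I l; t] [:: w; p; q] <= 8 + r l.
  rewrite /esum !big_cons !big_nil kw tw /r.
  have := m_le2 k p; have := m_le2 k q; have := m_le2 t p; have := m_le2 t q.
  by move: (m (I l) w) (m (I l) p) (m (I l) q); lia.
move=> lt_c; apply/hasP; apply: contraLR lt_c => /hasPn le2; rewrite -leqNgt.
rewrite (perm_big _ (perm_to_rem i_c)) big_cons.
have : \sum_(l <- rem i c) esum m [:: k; I l; t] [:: w; p; q] <= 10 * size (rem i c).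
  have : all (fun l => r l <= 2) (rem i c).
    apply/allP=> l; rewrite mem_rem_uniq // inE => /andP[ne_li l_c].
    by have := le2 l l_c; rewrite eq_sym ne_li /= -ltnNge.
  elim: (rem i c) => [|l s IH] /=; first by rewrite big_nil.
  case/andP=> r_l /IH{}IH; rewrite big_cons mulnS leq_add //.
  by apply: leq_trans (le8 l) _; rewrite -[10]/(8 + 2) leq_add2l.
rewrite size_rem //; have := le8 i; have : r i <= 6.
  by rewrite /r; have := m_le2 (I i) w; have := m_le2 (I i) p; have := m_le2 (I i) q; lia.
move=> r6 le_i le_s; apply: leq_trans (leq_add le_i le_s) _.
by move: gt1_c r6; move: (r i) (size c); lia.
Qed.

(** * The exchange on I, K and T *)

Section Exchange.

(* The notations of the computation above: I is [:: x; v; z], K is [:: y; p; q]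
   and T is [:: s0; s1; s2]. *)
Variables x v z y p q s0 s1 s2 : V.
Let I n := nth x [:: x; v; z] n.
Let K n := nth x [:: y; p; q] n.
Let S n := nth x [:: s0; s1; s2] n.
Let b := [:: m x y; m x p; m x q; m v y; m v p; m v q; m z y; m z p; m z q;
             m p q; m q y; m y p].
Let a := [:: m x s0; m x s1; m x s2; m v s0; m v s1; m v s2; m z s0; m z s1; m z s2].
Let F := [:: (x, v, z); (y, p, q); (s0, s1, s2)].
Hypotheses (xy : 2 <= m x y) (zy : 1 <= m z y) (xz : m x z = 0).
Hypotheses (xv : m x v = 0) (zv : m z v = 0).
Hypotheses (vpq : 5 <= m v p + m v q + m p q) (vqp : m v q <= m v p).
Hypothesis IK : 13 <= m x p + m x q + m v y + m z p + m z q + m q y + m y p.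
Hypotheses (s01 : 2 <= m s0 s1) (s02 : 2 <= m s0 s2) (s12 : 1 <= m s1 s2).
Hypothesis IT : 13 <= sumn a.
Hypothesis IT21 : m x s2 + m v s2 + m z s2 <= m x s1 + m v s1 + m z s1.

Lemma third i j : i < 3 -> j < 3 -> i != j ->
  exists l, perm_eq [:: i; j; l] (iota 0 3).
Proof.
by move: i j => [|[|[|?]]] [|[|[|?]]] // _ _ _;
  [exists 2 | exists 1 | exists 2 | exists 0 | exists 1 | exists 0].
Qed.

Lemma perm_nxt (A : eqType) (x0 x1 x2 : A) (d : A) k : k < 3 ->
  let f := nth d [:: x0; x1; x2] in
  perm_eq [:: f k; f (nxt k); f (prv k)] [:: x0; x1; x2].
Proof. by move: k => [|[|[|?]]] // _; apply/permP=> P /=; lia. Qed.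

Lemma ikE i k : i < 3 -> k < 3 -> ik b i k = m (I i) (K k).
Proof. by move: i k => [|[|[|?]]] [|[|[|?]]]. Qed.

Lemma ikaE i k : i < 3 -> k < 3 -> ik a i k = m (I i) (S k).
Proof. by move: i k => [|[|[|?]]] [|[|[|?]]]. Qed.

Lemma kkE k : k < 3 -> kk b k = m (K (nxt k)) (K (prv k)).
Proof. by move: k => [|[|[|?]]]. Qed.

Lemma nxt_lt k : nxt k < 3. Proof. by move: k => [|[|[|[|?]]]]. Qed.
Lemma prv_lt k : prv k < 3. Proof. by move: k => [|[|[|[|?]]]]. Qed.

Lemma ktileP k i : k < 3 -> i < 3 -> ktile b k i ->
  tile m 5 (I i, K (nxt k), K (prv k)).
Proof.
move=> lt_k lt_i; rewrite /ktile !ikE ?nxt_lt ?prv_lt // kkE // tile5E // /wt /=.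
by lia.
Qed.

Lemma ttileP k i : k < 3 -> i < 3 -> ttile a k i ->
  tile m 5 (I i, S (nxt k), S (prv k)).
Proof.
move=> lt_k lt_i; rewrite /ttile !ikaE ?nxt_lt ?prv_lt // tile5E // /wt /=.
suff : (if k is 0 then 1 else 2) <= m (S (nxt k)) (S (prv k)) by lia.
by move: k lt_k => [|[|[|?]]] //=; rewrite mC.
Qed.

Let KI := info_of (ktile b) b.
Let TI := info_of (ttile a) a.

Lemma mkE i k : i < 3 -> k < 3 -> mk KI i k = m (I i) (K k).
Proof. by move: i k => [|[|[|?]]] [|[|[|?]]]. Qed.

Lemma mtE i k : i < 3 -> k < 3 -> mt TI i k = m (I i) (S k).
Proof. by move: i k => [|[|[|?]]] [|[|[|?]]]. Qed.

Lemma tkE i k : i < 3 -> k < 3 -> tk KI k i = ktile b k i.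
Proof. by move: i k => [|[|[|?]]] [|[|[|?]]]. Qed.

Lemma ttE i k : i < 3 -> k < 3 -> tt TI k i = ttile a k i.
Proof. by move: i k => [|[|[|?]]] [|[|[|?]]]. Qed.

(** All entries are positive: the seven terms of [IK] are at most 2 and sum to at least 13, and
    likewise the three terms of [vpq] reach 5. *)
Lemma b_in_words : b \in ik_words.
Proof.
rewrite mem_filter; apply/andP; split.
  apply/and4P; split; [|exact: vpq|exact: vqp|exact: IK].
  by rewrite eqn_leq m_le2.
apply: mem_words => //; rewrite /b /= !inE.
have pos : forall c d, 0 < m c d -> (m c d == 1) || (m c d == 2).
  by move=> c d; have := m_le2 c d; case: (m c d) => [|[|[|?]]].
move: (m_le2 x p) (m_le2 x q) (m_le2 v y) (m_le2 v p) (m_le2 v q) (m_le2 z p).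
move: (m_le2 z q) (m_le2 p q) (m_le2 q y) (m_le2 y p) => *.
by rewrite !pos //; lia.
Qed.

Lemma a_in_words : a \in it_words.
Proof.
rewrite mem_filter; apply/andP; split; first by rewrite IT; apply: IT21.
apply: mem_words => //; rewrite /a /= !inE.
have le2 c d : [|| m c d == 0, m c d == 1 | m c d == 2].
  by have := m_le2 c d; case: (m c d) => [|[|[|?]]].
by rewrite !le2.
Qed.

Lemma words_ok : some_good (it_data a) (ik_data b).
Proof.
have /allP/(_ (it_data a) (map_f it_data a_in_words)) := always_good.
by move=> /allP/(_ (ik_data b) (map_f ik_data b_in_words)).
Qed.

Lemma perm_I i i1 i2 : perm_eq [:: i; i1; i2] (iota 0 3) ->
  perm_eq [:: I i; I i1; I i2] [:: x; v; z].
Proof. by move=> /(perm_map I). Qed.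

Lemma IK_gt0 i k : i < 3 -> k < 3 -> 0 < m (I i) (K k).
Proof.
move: i k => [|[|[|?]]] [|[|[|?]]] // _ _; rewrite /I /K /=;
move: (m_le2 x p) (m_le2 x q) (m_le2 v y) (m_le2 v p) (m_le2 v q) (m_le2 z p);
move: (m_le2 z q) (m_le2 p q) (m_le2 q y) (m_le2 y p); lia.
Qed.

Lemma centerP (k t i : nat) : k < 3 -> t < 3 -> i < 3 -> center KI TI k t i ->
  0 < m (I i) (S t) /\ exists i1 i2, [/\ perm_eq [:: i; i1; i2] (iota 0 3),
    tile m 5 (I i1, K (nxt k), K (prv k)) & tile m 5 (I i2, S (nxt t), S (prv t))].
Proof.
move=> lt_k lt_t lt_i; rewrite /center mtE // !tkE ?nxt_lt ?prv_lt //.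
rewrite !ttE ?nxt_lt ?prv_lt //; case: (m _ _) => //= ?.
have perm1 : perm_eq [:: i; nxt i; prv i] (iota 0 3).
  by move: i lt_i => [|[|[|?]]].
have perm2 : perm_eq [:: i; prv i; nxt i] (iota 0 3).
  by move: i lt_i {perm1} => [|[|[|?]]].
case: ifP => [|_]; [case: ifP => // K5 T5 _|case: ifP => // K5 T5]; split=> //.
  by exists (nxt i), (prv i); split=> //; [apply: ktileP | apply: ttileP];
  rewrite ?nxt_lt ?prv_lt.
by exists (prv i), (nxt i); split=> //; [apply: ktileP | apply: ttileP];
  rewrite ?nxt_lt ?prv_lt.
Qed.

Variable rest : seq (trip V).
Hypotheses (part_F : part (F ++ rest)) (rest5 : all (tile m 5) rest).

Lemma part_center (k t i i1 i2 : nat) : k < 3 -> t < 3 ->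
    perm_eq [:: i; i1; i2] (iota 0 3) ->
  part ([:: (K k, I i, S t); (I i1, K (nxt k), K (prv k));
            (I i2, S (nxt t), S (prv t))] ++ rest).
Proof.
move=> lt_k lt_t /perm_I permI; rewrite (perm_part (ts' := F ++ rest)) //.
rewrite !vseq_cat perm_cat2r.
exact: perm_transversal permI (perm_nxt y p q x lt_k) (perm_nxt s0 s1 s2 x lt_t).
Qed.

(** Above the cap, some path k - i - t that can be left over closes up to a 4-triangle. *)
Lemma capsP : solved m \/
  forall k t : nat, k < 3 -> t < 3 -> m (K k) (S t) <= cap KI TI k t.
Proof.
have [le_cap|] := boolP (all (fun k => all (fun t =>
    m (K k) (S t) <= cap KI TI k t) (iota 0 3)) (iota 0 3)).
  right=> k t lt_k lt_t; have := allP le_cap k; rewrite mem_iota => /(_ lt_k).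
  by move=> /allP/(_ t); rewrite mem_iota => /(_ lt_t).
case/allPn=> k; rewrite mem_iota => /andP[_ lt_k] /allPn[t].
rewrite mem_iota => /andP[_ lt_t] gt_cap.
left; suff /hasP[i] : has (fun i => center KI TI k t i &&
    (3 - (mk KI i k + mt TI i t) < m (K k) (S t))) (iota 0 3).
  rewrite mem_iota => /andP[_ lt_i] /andP[c_i].
  have [it_gt0 [i1 [i2 [perm_i K5 S5]]]] := centerP lt_k lt_t lt_i c_i.
  rewrite mkE // mtE // => gt_i; have ik_gt0 := IK_gt0 lt_i lt_k.
  exists (K k, I i, S t), [:: (I i1, K (nxt k), K (prv k)),
                            (I i2, S (nxt t), S (prv t)) & rest].
  split; [exact: part_center| |by rewrite /= K5 S5].
  rewrite tile4E // /wt /= (mC (K k) (I i)) ik_gt0 it_gt0 /=; lia.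
apply: contraR gt_cap => /hasPn no_i; rewrite /cap.
elim: (iota 0 3) no_i => [|i s IH] no_i /=; first exact: m_le2.
have le_s := IH (fun j j_s => no_i j (mem_behead (s := i :: s) j_s)).
case: ifP => // c_i; rewrite leq_min le_s andbT.
by have := no_i i (mem_head _ _); rewrite c_i /= -leqNgt.
Qed.

Section Capped.

Hypothesis capped :
  forall k t : nat, k < 3 -> t < 3 -> m (K k) (S t) <= cap KI TI k t.

Let dI i := nth 0 (rows b) i + nth 0 (rows a) i.

Lemma degI_E i : i < 3 -> esum m [:: I i] (vseq F) = dI i.
Proof.
move: i => [|[|[|?]]] // _; rewrite /esum /vseq /dI /rows /ik /b /a /I /=
  !big_cons !big_nil /=;
move: (mC v x) (mC z x) (mC z v) (mxx x) (mxx v) (mxx z) xv xz zv; lia.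
Qed.

Lemma degK_le k : k < 3 ->
  esum m [:: K k] (vseq F) <= nth 0 (degK b) k + sumn (map (cap KI TI k) (iota 0 3)).
Proof.
move=> lt_k.
have := (capped lt_k (isT : 0 < 3), capped lt_k (isT : 1 < 3)).
have := capped lt_k (isT : 2 < 3).
move: k lt_k => [|[|[|?]]] // _ c2 [c0 c1].
all: rewrite [sumn _]/= /esum /vseq /degK /kk /ik /b /K /= !big_cons !big_nil /= !mxx.
all: rewrite ?(mC y x) ?(mC y v) ?(mC y z) ?(mC p x) ?(mC p v) ?(mC p z).
all: rewrite ?(mC q x) ?(mC q v) ?(mC q z) ?(mC q p) ?(mC p y) ?(mC y q).
all: by move: c0 c1 c2; rewrite /K /S /=; lia.
Qed.

(** The 4 bounds the degree inside T. *)
Lemma degT_le (t : nat) : t < 3 -> esum m [:: S t] (vseq F) <=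
  4 + sumn (map (fun i => mt TI i t) (iota 0 3)) +
      sumn (map ((cap KI TI)^~ t) (iota 0 3)).
Proof.
move=> lt_t.
have := (capped (isT : 0 < 3) lt_t, capped (isT : 1 < 3) lt_t).
have := capped (isT : 2 < 3) lt_t.
rewrite /= !mtE //; move: t lt_t => [|[|[|?]]] // _ c2 [c0 c1].
all: rewrite /esum /vseq /S /= !big_cons !big_nil /= !mxx.
all: rewrite ?(mC s0) ?(mC s1 x) ?(mC s1 v) ?(mC s1 z) ?(mC s1 y) ?(mC s1 p) ?(mC s1 q).
all: rewrite ?(mC s2 x) ?(mC s2 v) ?(mC s2 z) ?(mC s2 y) ?(mC s2 p) ?(mC s2 q).
all: have := (m_le2 s1 s0, m_le2 s2 s0, m_le2 s1 s2, m_le2 s2 s1, m_le2 s0 s1).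
all: by move: c0 c1 c2; rewrite /K /S /I /= => ? ? ? [[[[? ?] ?] ?] ?]; lia.
Qed.

(** Per path, 33 = 3(4 * 3 - 1) is the averaging threshold for three vertices and three triples. *)
Lemma exists_centers : exists (k t : nat) (c : seq nat),
  [/\ k < 3, t < 3, all (ktile b k) (iota 0 3) &
   [/\ subseq c (iota 0 3), 1 < size c, all (center KI TI k t) c &
       \sum_(i <- c) esum m [:: K k; I i; S t] (vseq F) < 33 * size c]].
Proof.
have := words_ok; rewrite /some_good.
have findP P : (find P (iota 0 3) < 3) = has P (iota 0 3) by rewrite has_find.
rewrite findP => /hasP[k]; rewrite mem_iota findP => /andP[_ lt_k] /hasP[t].
rewrite mem_iota => /andP[_ lt_t]; case: ifP => // K5; rewrite /good.
set c := filter _ _; case: ifP => // gt1_c lt_deg.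
have c_sub : subseq c (iota 0 3) by apply: filter_subseq.
exists k, t, c; split=> //.
  by apply/allP=> i i3; rewrite -tkE ?(allP K5) //; move: i3; rewrite mem_iota.
split=> //; first exact: filter_all.
apply: leq_ltn_trans lt_deg.
elim: c {gt1_c c_sub} (mem_subseq c_sub) => [|i c IH] c_lt3; first by rewrite big_nil.
rewrite big_cons /= mulSn addnACA leq_add ?IH //; last first.
  by move=> j j_c; apply: c_lt3; rewrite inE j_c orbT.
have lt_i : i < 3 by have := c_lt3 i (mem_head _ _); rewrite mem_iota.
rewrite -[[:: K k; _; _]]/([:: K k] ++ [:: I i] ++ [:: S t]) !esum_catl degI_E //.
rewrite addnCA; apply: leq_add; first exact: leqnn.
by apply: leq_add; [apply: degK_le | apply: degT_le].
Qed.

Lemma capped_solved : solved m.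
Proof.
have [k [t [c [lt_k lt_t K5 [c_sub gt1_c ctr_c lt_deg]]]]] := exists_centers.
have c_lt3 i : i \in c -> i < 3 by move/(mem_subseq c_sub); rewrite mem_iota.
(* [K k] and [S t] occur once for each centre, so that the average runs over whole paths. *)
pose R := flatten [seq [:: K k; I i; S t] | i <- c].
have size_R : size R = 3 * size c.
  by rewrite /R; elim: (c) => //= i s ->; rewrite mulnS.
have esumR Y : esum m R Y = \sum_(i <- c) esum m [:: K k; I i; S t] Y.
  by rewrite /R esum_flatten big_map.
have [|T [rest' [eq_rest part_FT]]] := exists_tile (S := R) part_F.
  by rewrite esumR size_R (_ : (4 * size F).-1 = 11) // (leq_trans lt_deg) //; lia.
rewrite size_R esumR => lt_T.
have /andP[T5 rest'5] : all (tile m 5) (T :: rest') by rewrite -(perm_all _ eq_rest).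
(* One of the paths sends more than the average of 12 edges to [T]. *)
have [i i_c lt12] : exists2 i, i \in c &
    12 < esum m [:: K k; I i; S t] (vseq [:: T]).
  apply/hasP; apply: contraLR lt_T => /hasPn le12; rewrite -leqNgt mulnA.
  elim: (c) le12 => [|i s IH] le12; first by rewrite big_nil.
  rewrite big_cons [size _]/= mulnS leq_add ?IH //.
    by have := le12 i (mem_head _ _); rewrite -leqNgt.
  by move=> j j_s; apply: le12; rewrite inE j_s orbT.
have lt_i := c_lt3 i i_c.
have [it_gt0 [i1 [i2 [perm_i u5 u'5]]]] := centerP lt_k lt_t lt_i (allP ctr_c i i_c).
have := part_center lt_k lt_t perm_i; move: u5 u'5.
move: (I i1, K (nxt k), K (prv k)) (I i2, S (nxt t), S (prv t)).
move=> u u' u5 u'5 part_u.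
have {part_u}part_T : part ([:: (K k, I i, S t); T] ++ [:: u, u' & rest']).
  rewrite -(perm_part (ts := [:: (K k, I i, S t); u; u'] ++ rest)) //.
  by apply: perm_vseq; apply: perm_insert.
have ki_gt0 := IK_gt0 lt_i lt_k.
(* Unless some [w] in the new tile is independent of both ends of the path, [connected_solved]
   concludes. *)
have [/hasP[w w_T /eqP bad_w]|/hasPn ok_T] := boolP (has (fun w =>
    m (K k) (S t) + m (K k) w + m (S t) w == 0) (vseq [:: T])); last first.
  have [|t4 [t5 [part_t t4P t5P]]] := connected_solved part_T _ it_gt0 T5 lt12 ok_T.
    by rewrite (mC (K k)) ki_gt0.
  by exists t4, [:: t5, u, u' & rest']; rewrite /= t5P u5 u'5.
have [p' [q' eqT]] : exists p' q', perm_eq (vseq [:: T]) (vseq [:: (w, p', q')]).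
  have := perm_to_rem w_T; have := size_rem w_T; rewrite size_vseq.
  by case: (rem w _) => [|p' [|q' [|? ?]]] // _ eqT; exists p', q'.
have eqTs Y : esum m Y (vseq [:: T]) = esum m Y [:: w; p'; q'].
  exact: esum_perm eqT.
have {lt_T}lt_T : 12 * size c < \sum_(i <- c) esum m [:: K k; I i; S t] [:: w; p'; q'].
  by move: lt_T; rewrite mulnA; under eq_bigr => l _ do rewrite eqTs.
rewrite {}eqTs in lt12; rewrite (perm_tile5 eqT) in T5.
move: bad_w => /eqP; rewrite !addn_eq0 => /andP[/andP[/eqP kt0 /eqP kw0] /eqP tw0].
have c_uniq : uniq c := subseq_uniq c_sub (iota_uniq 0 3).
have [j j_c /andP[ne_ij r_j]] := exists_transfer c_uniq gt1_c i_c kw0 tw0 lt_T.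
have [l perm_ijl] := third lt_i (c_lt3 j j_c) ne_ij.
have lt_l : l < 3.
  have : l \in [:: i; j; l] by rewrite !inE eqxx !orbT.
  by rewrite (perm_mem perm_ijl) mem_iota.
have kj_gt0 := IK_gt0 (c_lt3 j j_c) lt_k.
(* Back from [part_center] to the triples of [F]: the tile [s0 s1 s2] is restored, and the third
   vertex [I l] completes K minus [K k]. *)
have part_L : part ([:: (I i, I j, K k); (w, p', q')] ++
                    [:: (I l, K (nxt k), K (prv k)), (s0, s1, s2) & rest']).
  rewrite -(perm_part (ts := (F ++ [:: T]) ++ rest')) // perm_sym.
  rewrite perm_sym in eqT.
  exact: (perm_final [:: s0; s1; s2] (vseq rest') (perm_I perm_ijl)
            (perm_nxt y p q x lt_k) eqT).
have [t4 [t5 [part_t t4P t5P]]] :=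
  transfer_solved part_L T5 ki_gt0 kj_gt0 kw0 tw0 lt12 r_j.
exists t4, [:: t5, (I l, K (nxt k), K (prv k)), (s0, s1, s2) & rest'].
have K5l : tile m 5 (I l, K (nxt k), K (prv k)).
  apply: ktileP => //; case/and4P: K5 => K0 K1 K2 _.
  by move: (l) lt_l => [|[|[|?]]].
split=> //; apply/and4P; split=> //.
by rewrite tile5E //; apply: leq_add (leq_add s01 s12) s02.
Qed.

End Capped.

Lemma exchange_solved : solved m.
Proof. by case: capsP => // capped; apply: capped_solved. Qed.

End Exchange.

Lemma path_solved x y z ts : part ((x, y, z) :: ts) -> all (tile m 5) ts ->
  2 <= m x y -> 1 <= m y z -> solved m.
Proof.
move=> part_L ts5 xy yz.
have [xz_gt0|] := ltnP 0 (m x z).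
  by exists (x, y, z), ts; split=> //; rewrite tile4E // /wt /=; lia.
rewrite leqn0 => /eqP xz.
(* As [x] and [z] are nonadjacent, the degrees inside the path sum to at most 8 < 3 * 3. *)
have /(exists_tile (Ls := [:: (x, y, z)]) (S := [:: x; y; z])) := part_L.
case=> [|T [rest [eq_ts part_T lt12]]].
  rewrite /esum /vseq /= !big_cons !big_nil !mxx.
  by have := m_le2 x y; have := m_le2 y z; rewrite (mC y x) (mC z x) (mC z y) xz /=; lia.
have /andP[T5 rest5] : all (tile m 5) (T :: rest) by rewrite -(perm_all _ eq_ts).
have [/hasP[v v_T /eqP bad_v]|/hasPn ok_T] := boolP (has (fun v =>
    m x z + m x v + m z v == 0) (vseq [:: T])); last first.
  have [t4 [t5 [part_t t4P t5P]]] := connected_solved part_T (ltnW xy) yz T5 lt12 ok_T.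
  by exists t4, (t5 :: rest); rewrite /= t5P.
have [p [q [eqT le_vqp]]] : exists p q,
    perm_eq (vseq [:: T]) [:: v; p; q] /\ m v q <= m v p.
  have := perm_to_rem v_T; have := size_rem v_T; rewrite size_vseq.
  case: (rem v _) => [|p [|q [|? ?]]] // _ eqT.
  have [le_qp|/ltnW le_pq] := leqP (m v q) (m v p); first by exists p, q.
  by exists q, p; split=> //; apply: perm_trans eqT (perm_tail _ _ _).
rewrite (esum_perm (perm_refl _) eqT) in lt12.
rewrite (perm_tile5 (t' := (v, p, q)) eqT) tile5E // /wt /= in T5.
move: bad_v => /eqP; rewrite !addn_eq0 => /andP[/andP[_ /eqP xv] /eqP zv].
rewrite /esum !big_cons !big_nil xv zv !addn0 !add0n in lt12.
(* Swapping [y] with [v] turns the path and the tile into I and K. *)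
have {part_T}part_I : part ([:: (x, v, z); (y, p, q)] ++ rest).
  rewrite -(perm_part (ts := ([:: (x, y, z)] ++ [:: T]) ++ rest)) //.
  rewrite 3!vseq_cat perm_cat2r.
  apply: perm_trans (_ : perm_eq ([:: x; y; z] ++ [:: v; p; q]) _).
    by rewrite perm_cat2l.
  exact: perm_middle.
have IK13 : 13 <= m x p + m x q + m v y + m z p + m z q + m q y + m y p.
  by move: lt12 (mC v y) (mC q y) => /=; lia.
(* I is independent, so its degrees into I and K sum to at most 18 < 3 * 7. *)
have := part_I => /(exists_tile (S := [:: x; v; z])).
case=> [|T2 [rest2 [eq_rest part_F lt12']]].
  rewrite /esum /vseq /= !big_cons !big_nil !mxx (mC v x) (mC z x) (mC v z) xv xz zv.
  have := (m_le2 x y, m_le2 x p, m_le2 x q, m_le2 v y, m_le2 v p, m_le2 v q).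
  have := (m_le2 z y, m_le2 z p, m_le2 z q).
  by move=> [[? ?] ?] [[[[[? ?] ?] ?] ?] ?]; lia.
have /andP[T25 rest25] : all (tile m 5) (T2 :: rest2) by rewrite -(perm_all _ eq_rest).
have zy : 1 <= m z y by rewrite mC.
have vpq : 5 <= m v p + m v q + m p q by rewrite addnAC.
have [s1 [s0 [s2 [eqT2 s10 s02 s12]]]] := five_order T25.
rewrite (esum_perm (perm_refl _) eqT2) in lt12'.
(* [s0] is the common end of two double edges; the other two vertices are named so that [s] receives
   at least as many edges from I as [s']. *)
have solve s s' : perm_eq (vseq [:: T2]) [:: s0; s; s'] -> 2 <= m s0 s ->
    2 <= m s0 s' -> 1 <= m s s' -> m x s' + m v s' + m z s' <= m x s + m v s + m z s ->
    12 < esum m [:: x; v; z] [:: s0; s; s'] -> solved m.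
  move=> eq_s m1 m2 m3 le_s gt12.
  have part_Fs : part ([:: (x, v, z); (y, p, q); (s0, s, s')] ++ rest2).
    rewrite -(perm_part (ts := ([:: (x, v, z); (y, p, q)] ++ [:: T2]) ++ rest2)) //.
    rewrite -[X in _ (vseq (X ++ _))]/([:: (x, v, z); (y, p, q)] ++ [:: (s0, s, s')]).
    by rewrite 4!vseq_cat perm_cat2r perm_cat2l.
  have IT : 13 <= sumn [:: m x s0; m x s; m x s'; m v s0; m v s; m v s';
                          m z s0; m z s; m z s'].
    by move: gt12; rewrite /esum !big_cons !big_nil /= !addn0 !addnA.
  exact: (exchange_solved xy zy xz xv zv vpq le_vqp IK13 m1 m2 m3 IT le_s part_Fs).
have perm1 := perm_head s1 s0 s2; have perm2 := perm_trans perm1 (perm_tail s0 s1 s2).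
rewrite mC in s10.
have [le_s|/ltnW le_s] := leqP (m x s2 + m v s2 + m z s2) (m x s1 + m v s1 + m z s1).
  apply: (solve s1 s2) => //; first exact: perm_trans eqT2 perm1.
  by rewrite -(esum_perm (perm_refl _) perm1).
apply: (solve s2 s1) => //; first exact: perm_trans eqT2 perm2.
  by rewrite mC.
by rewrite -(esum_perm (perm_refl _) perm2).
Qed.

Lemma leftover_solved L ts : part (L :: ts) -> all (tile m 5) ts -> solved m.
Proof.
move=> part_L ts5.
have [//|[[[a b] c] [ts' [part_L' L3 ts'5]]]] := to_path part_L ts5.
have reorder x y z : perm_eq [:: a; b; c] [:: x; y; z] ->
    2 <= m x y -> 1 <= m y z -> solved m.
  move=> eqL; apply: path_solved ts'5.
  by rewrite -(part_perm1 (T := (a, b, c)) [::]).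
move: L3; rewrite /tile /= !andbT orbF.
case/or4P=> [|||/or3P[]] /andP[m1 m2].
- exact: (reorder a b c).
- by apply: (reorder b a c); rewrite ?perm_head // (mC b a).
- apply: (reorder b c a); rewrite // 1?(mC c a) //.
  exact: perm_trans (perm_head a b c) (perm_tail b a c).
- apply: (reorder c b a); rewrite 1?(mC c b) 1?(mC b a) //.
  exact: perm_trans (perm_trans (perm_head a b c) (perm_tail b a c)) (perm_head b c a).
- apply: (reorder c a b); rewrite 1?(mC c a) //.
  exact: perm_trans (perm_tail a b c) (perm_head a c b).
- by apply: (reorder a c b); rewrite ?perm_tail // (mC c b).
Qed.

End Core.

(** * Induction on the number of missing edges *)

Section Induction.

Variables (V : finType) (k : nat).
Hypotheses (cardV : #|V| = 3 * k) (k_gt0 : 0 < k).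

Lemma vseq_exists (s : seq V) n : size s = 3 * n -> exists ts, vseq ts = s.
Proof.
elim: n s => [|n IH] s; first by rewrite muln0 => /size0nil->; exists [::].
rewrite mulnS; case: s => [|a [|b [|c s]]] //= [] /IH[ts <-].
by exists ((a, b, c) :: ts).
Qed.

Lemma complete_solved (m : V -> V -> nat) :
  (forall x y, m x y <= 2) -> (forall x y, x != y -> m x y = 2) -> solved m.
Proof.
move=> m_le2 m2; have [|ts eq_ts] := @vseq_exists (enum V) k.
  by rewrite -cardE.
have uniq_ts : uniq (vseq ts) by rewrite eq_ts enum_uniq.
have part_ts : part ts by rewrite /part eq_ts.
have: all (tile m 5) ts.
  elim: ts uniq_ts {eq_ts part_ts} => //= -[[a b] c] ts IH.
  rewrite /vseq /= !inE !negb_or -!andbA => /and5P[ab ac _ bc /and3P[_ _ /IH->]].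
  by rewrite andbT tile5E // /wt /= !m2.
case: ts part_ts {eq_ts uniq_ts} => [part0|t ts part_t /andP[t5 ts5]].
  have := perm_size part0; rewrite -cardE cardV /=; lia.
by exists t, ts; split=> //; apply: tile54.
Qed.

Section AddEdge.

Variables (m : V -> V -> nat) (x y : V).
Hypotheses (ne_xy : x != y) (m_le2 : forall u v, m u v <= 2).

Definition add_edge (u v : V) : nat :=
  m u v + ((u == x) && (v == y) || (u == y) && (v == x)).

Definition contains_xy (t : trip V) : bool :=
  (x \in vseq [:: t]) && (y \in vseq [:: t]).

Lemma add_edge_out j t : ~~ contains_xy t -> tile add_edge j t -> tile m j t.
Proof.
case: t => -[a b] c; rewrite /contains_xy /vseq /= !inE => no_xy.
suff eq_m u v : u \in [:: a; b; c] -> v \in [:: a; b; c] -> add_edge u v = m u v.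
  by rewrite /tile /= !eq_m ?inE ?eqxx ?orbT.
rewrite /add_edge !inE => u_t v_t; case: andP => [[/eqP Du /eqP Dv]|_].
  by move: no_xy; rewrite -Du -Dv u_t v_t.
case: andP => [[/eqP Du /eqP Dv]|_]; last by rewrite addn0.
by move: no_xy; rewrite -Du -Dv u_t v_t.
Qed.

Lemma add_edge_wt t : uniq (vseq [:: t]) -> wt add_edge t <= (wt m t).+1.
Proof.
case: t => -[a b] c; rewrite /vseq /wt /add_edge /= !inE negb_or andbT.
case/andP=> /andP[ab ac] bc.
suff : ((a == x) && (b == y) || (a == y) && (b == x)) +
       ((b == x) && (c == y) || (b == y) && (c == x)) +
       ((a == x) && (c == y) || (a == y) && (c == x)) <= 1 by lia.
have once z : (a == z) + (b == z) + (c == z) <= 1.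
  case: (eqVneq a z) => [Da|_]; case: (eqVneq b z) => [Db|_];
    case: (eqVneq c z) => [Dc|_] //; move: ab ac bc;
    by rewrite ?Da ?Db ?Dc eqxx ?andbF.
move: (once x) (once y).
by do 6 case: (_ == _).
Qed.

End AddEdge.

Lemma core m : (forall x y, m x y = m y x) -> (forall x, m x x = 0) ->
    (forall x y, m x y <= 2) -> (forall x : V, 4 * k <= (\sum_y m x y).+1) ->
  solved m.
Proof.
(* The sum runs over ordered pairs; the diagonal only adds a constant. *)
have [d] := ubnP (\sum_(u : V * V) (2 - m u.1 u.2)).
elim: d m => // d IH m lt_d mC mxx m_le2 deg_ge.
have [/existsP[[x y] /= /andP[ne_xy lt2]]|] :=
    boolP [exists u : V * V, (u.1 != u.2) && (m u.1 u.2 < 2)]; last first.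
  rewrite negb_exists => /forallP full; apply: complete_solved => // x y ne_xy.
  have := full (x, y); rewrite /= ne_xy /= -leqNgt => ge2.
  by apply/eqP; rewrite eqn_leq m_le2.
have {IH lt_d} [t0 [ts [part_ts t0P tsP]]] : solved (add_edge m x y).
  apply: IH => [|u v|u|u v|u].
  - apply: leq_trans (lt_d : _ <= d).
    rewrite (bigD1 (x, y)) //= [leqRHS](bigD1 (x, y)) //= -addSn leq_add //.
      by rewrite /add_edge !eqxx /=; lia.
    by apply: leq_sum => u _; rewrite leq_sub2l // leq_addr.
  - by rewrite /add_edge mC orbC ![(v == _) && _]andbC.
  - rewrite /add_edge mxx add0n; case: eqP => [->|_] /=; last by rewrite andbF.
    by rewrite (negPf ne_xy).
  - rewrite /add_edge; case: andP => [[/eqP-> /eqP->]|_]; first by rewrite addn1.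
    case: andP => [[/eqP-> /eqP->]|_]; first by rewrite mC addn1.
    by rewrite addn0.
  - by apply: leq_trans (deg_ge u) _; rewrite ltnS leq_sum // => v _; apply: leq_addr.
have leftover L rest : part (L :: rest) -> all (tile m 5) rest -> solved m.
  exact: (leftover_solved mC mxx m_le2 cardV deg_ge).
have uniq_part (us : seq (trip V)) : part us -> uniq (vseq us).
  by move=> part_us; rewrite (perm_uniq part_us) enum_uniq.
have rest_out t rest : part (t :: rest) -> contains_xy x y t ->
    all (predC (contains_xy x y)) rest.
  move=> /uniq_part; rewrite -cat1s vseq_cat cat_uniq => /and3P[_ /hasPn disj _].
  case/andP=> x_t _; apply/allP=> u u_rest; apply/negP=> /andP[x_u _].
  have /disj : x \in vseq rest.
    by apply/flatten_mapP; exists u => //; move: x_u; rewrite /vseq /= !inE.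
  by rewrite /= x_t.
have out5 rest : all (predC (contains_xy x y)) rest ->
    all (tile (add_edge m x y) 5) rest -> all (tile m 5) rest.
  move=> out t5; apply/allP=> t t_rest; apply: add_edge_out (allP t5 t t_rest).
  exact: (allP out t t_rest).
have double t : 5 <= wt (add_edge m x y) t -> uniq (vseq [:: t]) -> tile m 2 t.
  move=> ge5 /(add_edge_wt m ne_xy) le_t; apply: tile42 => //.
  by rewrite -ltnS (leq_trans ge5).
have add_le2 u v : add_edge m x y u v <= 2.
  rewrite /add_edge; case: andP => [[/eqP-> /eqP->]|_]; first by rewrite addn1.
  case: andP => [[/eqP-> /eqP->]|_]; first by rewrite mC addn1.
  by rewrite addn0.
(* If the added edge lies in the 4-triangle, all other tiles survive its removal and [t0] is the
   triple left over. *)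
have [t0_xy|t0_xy] := boolP (contains_xy x y t0).
  exact: leftover part_ts (out5 _ (rest_out _ _ part_ts t0_xy) tsP).
have t04 := add_edge_out t0_xy t0P.
have [/hasP[t t_ts t_xy]|] := boolP (has (contains_xy x y) ts); last first.
  by rewrite -all_predC => no_xy; exists t0, ts; split=> //; apply: out5.
have eq_ts := perm_to_rem t_ts; move: (rem t ts) eq_ts => rest eq_ts.
have /andP[t5 rest5] : all (tile (add_edge m x y) 5) (t :: rest).
  by rewrite -(perm_all _ eq_ts).
have part_t : part (t :: t0 :: rest).
  rewrite -(perm_part (ts := t0 :: ts)) //; apply: perm_vseq.
  by apply: perm_trans (permEl (perm_catCA [:: t0] [:: t] rest)); rewrite perm_cons.
have /andP[_ rest_xy] := rest_out _ _ part_t t_xy.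
(* Without the added edge, [t] still has weight at least 4 and hence a double edge, as does the
   4-triangle [t0]. *)
have [||L [us [part_L us5]]] :=
    doubles_to_leftover mC mxx m_le2 cardV deg_ge part_t _ _ (out5 _ rest_xy rest5).
- apply: double; first by rewrite -tile5E.
  by move: (uniq_part _ part_t); rewrite -cat1s vseq_cat cat_uniq => /and3P[].
- by move: t04; rewrite tile4E // => /andP[? _]; apply: tile42.
- exact: leftover part_L us5.
Qed.

End Induction.

(** * Reduction to a number of vertices divisible by 3 *)

Definition packing (V : finType) (m : V -> V -> nat) (k : nat) : Prop :=
  k = 0 \/ exists t ts, [/\ uniq (vseq (t :: ts)), tile m 4 t, all (tile m 5) ts
                          & size (t :: ts) = k].

Lemma packing3 (V : finType) (m : V -> V -> nat) k :
    (forall x y, m x y = m y x) -> (forall x, m x x = 0) ->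
    (forall x y, m x y <= 2) -> #|V| = 3 * k ->
    (forall x : V, 4 * k <= (\sum_y m x y).+1) ->
  packing m k.
Proof.
move=> mC mxx m_le2 cardV deg_ge; case: (posnP k) => [|k_gt0]; first by left.
right; have [t [ts [part_t t4 ts5]]] := core cardV k_gt0 mC mxx m_le2 deg_ge.
exists t, ts; split=> //; first by rewrite (perm_uniq part_t) enum_uniq.
apply/eqP; rewrite -(eqn_pmul2l (isT : 0 < 3)) -size_vseq (perm_size part_t).
by rewrite -cardE cardV.
Qed.

Definition map_trip (A B : Type) (f : A -> B) (t : trip A) : trip B :=
  (f t.1.1, f t.1.2, f t.2).

Lemma vseq_map (A B : Type) (f : A -> B) ts :
  vseq (map (map_trip f) ts) = map f (vseq ts).
Proof. by rewrite /vseq map_flatten -!map_comp. Qed.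

Lemma packing_map (V W : finType) (f : W -> V) (m : V -> V -> nat) k :
    injective f -> packing (fun x y => m (f x) (f y)) k -> packing m k.
Proof.
move=> inj_f [->|[t [ts [uniq_ts t4 ts5 size_ts]]]]; first by left.
right; exists (map_trip f t), (map (map_trip f) ts); split=> //.
- by rewrite -map_cons vseq_map map_inj_uniq.
- by rewrite all_map.
- by rewrite /= size_map.
Qed.

Lemma sum_option (V : finType) (F : option V -> nat) :
  \sum_u F u = F None + \sum_x F (Some x).
Proof.
rewrite (bigD1 None) //=; congr (_ + _).
rewrite (reindex_omap Some id) => [|[x|] //].
by apply: eq_bigl => x; rewrite eqxx.
Qed.

Lemma packing_any (V : finType) (m : V -> V -> nat) n :
    (forall x y, m x y = m y x) -> (forall x, m x x = 0) ->
    (forall x y, m x y <= 2) -> #|V| = n ->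
    (forall x : V, 4 * n <= 3 * (\sum_y m x y) + 3) ->
  packing m (n %/ 3).
Proof.
move=> mC mxx m_le2 cardV deg_ge; have Dn := divn_eq n 3.
have := ltn_pmod n (isT : 0 < 3); set k := n %/ 3 in Dn *.
case Dr: (n %% 3) Dn => [|[|[|//]]] Dn _.
- by apply: packing3 => // [|x]; [lia | have := deg_ge x; lia].
(* With n = 3k + 1, deleting any vertex costs each degree at most 2, which leaves 3d >= 12k - 5 and
   so d >= 4k - 1. *)
- have /card_gt0P[x0 _] : 0 < #|V| by lia.
  apply: (packing_map (f := val : {x in predC1 x0} -> V)); first exact: val_inj.
  apply: packing3 => // [|x].
    by rewrite card_sig -[#|_|]/#|predC1 x0| cardC1 cardV Dn addn1 mulnC.
  have -> : \sum_(y : {x in predC1 x0}) m (val x) (val y) =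
      \sum_(y | y != x0) m (val x) y.
    by rewrite -(big_sub (predC1 x0) (m (val x))); apply: eq_bigl.
  have bound s : 4 * n <= 3 * (m (sval x) x0 + s) + 3 -> 4 * k <= s.+1.
    by have := m_le2 (sval x) x0; lia.
  by apply: bound; have := deg_ge (sval x); rewrite (bigD1 x0).
pose m' (u v : option V) := match u, v with
  | Some x, Some y => m x y | None, None => 0 | _, _ => 2 end.
have : packing m' k.+1.
  apply: packing3 => [[x|] [y|]|[x|]|[x|] [y|]||[x|]] //=.
  - by rewrite card_option; lia.
  - rewrite sum_option /=; have := deg_ge x; lia.
  - rewrite sum_option /= sum_nat_const cardT -cardE cardV; lia.
case=> // [[t [ts [uniq_ts t4 ts5 size_ts]]]].
have [k0|k_gt0] := posnP k; first by left.
have strip (us : seq (trip (option V))) : None \notin vseq us ->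
    exists us', us = map (map_trip (@Some V)) us'.
  elim: us => [_|[[a b] c] us IH]; first by exists [::].
  rewrite /vseq /= !inE !negb_or => /and4P[].
  case: a b c => [a|] [b|] [c|] //= _ _ _ /IH[us' ->].
  by exists ((a, b, c) :: us').
have uniq_strip us : uniq (vseq (map (map_trip (@Some V)) us)) -> uniq (vseq us).
  by rewrite vseq_map map_inj_uniq // => ? ? [].
have uniq_vts : uniq (vseq ts).
  by move: uniq_ts; rewrite -cat1s vseq_cat cat_uniq => /and3P[].
(* If the 4-triangle is lost, a 5-triangle takes its place. *)
have [t_None|t_Some] := boolP (None \in vseq [:: t]).
  have [|us Dts] := strip ts.
    move: uniq_ts; rewrite -cat1s vseq_cat cat_uniq => /and3P[_ /hasPn disj _].
    by apply/negP=> /disj; rewrite /= t_None.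
  move: ts5 uniq_vts size_ts; rewrite {}Dts => us5 /uniq_strip uniq_us [].
  rewrite size_map => size_us; right.
  case: us size_us us5 uniq_us => [k0|u us us_k /andP[u5 us5] uniq_us].
    by rewrite -k0 in k_gt0.
  exists u, us; split=> //; first exact: tile54.
  by have : all (tile m' 5) (map (map_trip (@Some V)) us) by []; rewrite all_map.
have [u u_ts no_None] : exists2 u, u \in ts & None \notin vseq (rem u ts).
  have [/flatten_mapP[u u_ts None_u]|no_None] := boolP (None \in vseq ts).
    exists u => //; have eq_ts := perm_vseq (perm_to_rem u_ts).
    move: uniq_vts; rewrite (perm_uniq eq_ts) -cat1s vseq_cat cat_uniq.
    by case/and3P=> _ /hasPn disj _; apply/negP=> /disj /negP.
  case: ts size_ts no_None {uniq_ts ts5 uniq_vts} => [[k0]|u us _ no_None].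
    by rewrite -k0 in k_gt0.
  exists u; rewrite ?mem_head //= eqxx; apply: contra no_None => None_us.
  by rewrite -cat1s vseq_cat mem_cat None_us orbT.
have [|[//|t' us] [Dt Drem]] := strip (t :: rem u ts).
  by rewrite -cat1s vseq_cat mem_cat negb_or t_Some.
right; exists t', us; split.
- suff: uniq (vseq (t :: rem u ts)) by rewrite Dt Drem; apply: (uniq_strip (t' :: us)).
  have: perm_eq (vseq (t :: ts)) (vseq [:: u] ++ vseq (t :: rem u ts)).
    rewrite -vseq_cat; apply: perm_vseq; rewrite perm_sym.
    apply: perm_trans (permEl (perm_catCA [:: u] [:: t] (rem u ts))) _.
    by rewrite perm_cons perm_sym perm_to_rem.
  by move/perm_uniq; rewrite uniq_ts cat_uniq => /esym/and3P[].
- by rewrite Dt in t4.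
- suff: all (tile m' 5) (map (map_trip (@Some V)) us) by rewrite all_map.
  by rewrite -Drem; apply/allP=> w /mem_rem; apply: (allP ts5).
- rewrite /= -(size_map (map_trip (@Some V))) -Drem size_rem //.
  by case: size_ts => ->; rewrite prednK.
Qed.

(** * From triples of vertices to sub-multigraphs *)

Section Multigraphs.

Variables (T : finType) (M : multigraph T).

Lemma mu_sym x y : mu M x y = mu M y x.
Proof. by rewrite /mu setUC. Qed.

Lemma mu_xx x : mu M x x = 0.
Proof.
apply/eqP; rewrite -leqn0 leqNgt; apply/negP=> /multP.
by rewrite setUid cards1.
Qed.

Lemma min_deg_le x : x \in vertices M -> min_deg M <= deg M x.
Proof.
rewrite /min_deg => x_M; move: (\max_(_ in _) _) => d.
elim: (index_enum T) (mem_index_enum x) => //= z s IH; rewrite inE big_cons.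
case/predU1P=> [<-|/IH le_x]; first by rewrite x_M geq_minl.
by case: ifP => // _; rewrite geq_min le_x orbT.
Qed.

(** A [k]-triangle has exactly [k] edges, so its multiplicities are taken from a pattern below those
    of [M]; for k = 4, 5 all three entries are positive. *)
Lemma ktriangle_of_tile k (t : trip T) : (k == 4) || (k == 5) ->
    uniq (vseq [:: t]) -> all (mem (vertices M)) (vseq [:: t]) ->
    tile (mu M) k t ->
  exists H, [/\ submultigraph H M, ktriangle k H
             & vertices H = [set x in vseq [:: t]]].
Proof.
case: t => -[a b] c; rewrite /vseq /= !inE negb_or !andbT => k45.
case/andP=> /andP[ab ac] bc /and3P[aM bM cM].
case/hasP=> [[[d1 d2] d3] q_k] /= /and3P[le1 le2 le3].
have [sum_d d1_gt0 d2_gt0 d3_gt0] : [/\ d1 + d2 + d3 = k, 0 < d1, 0 < d2 & 0 < d3].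
  by case/orP: k45 q_k => /eqP->; rewrite !inE => /or3P[] /eqP[-> -> ->].
pose A := [set x in [:: a; b; c]].
pose f (e : {set T}) := if e == [set a; b] then d1 else
  if e == [set b; c] then d2 else if e == [set a; c] then d3 else 0.
have fP e : 0 < f e -> (#|e| == 2) && (e \subset A).
  have sub2 u v : u != v -> u \in A -> v \in A ->
      (#|[set u; v]| == 2) && ([set u; v] \subset A).
    by rewrite cards2 subUset !sub1set => -> -> ->.
  rewrite /f; have [-> _|_] := eqVneq e [set a; b].
    by apply: sub2; rewrite ?inE ?eqxx ?orbT.
  have [-> _|_] := eqVneq e [set b; c]; first by apply: sub2; rewrite ?inE ?eqxx ?orbT.
  have [-> _|_ //] := eqVneq e [set a; c].
  by apply: sub2; rewrite ?inE ?eqxx ?orbT.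
have ne1 : [set b; c] != [set a; b].
  by apply/eqP=> /setP/(_ a); rewrite !inE eqxx (negPf ab) (negPf ac).
have ne2 : [set a; c] != [set a; b].
  by apply/eqP=> /setP/(_ b); rewrite !inE eqxx orbT eq_sym (negPf ab) (negPf bc).
have ne3 : [set a; c] != [set b; c].
  by apply/eqP=> /setP/(_ a); rewrite !inE eqxx (negPf ab) (negPf ac).
have f1 : f [set a; b] = d1 by rewrite /f eqxx.
have f2 : f [set b; c] = d2 by rewrite /f (negPf ne1) eqxx.
have f3 : f [set a; c] = d3 by rewrite /f (negPf ne2) (negPf ne3) eqxx.
exists (Multigraph fP); split=> //.
  apply/andP; split.
    by apply/subsetP=> x; rewrite !inE => /or3P[] /eqP->.
  apply/forallP=> e /=; rewrite /f.
  by case: eqP => [->|_] //; case: eqP => [->|_] //; case: eqP => [->|_].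
apply/and3P; split.
- by rewrite /num_vertices cardsE (card_uniqP _) //= !inE negb_or ab ac bc.
- apply/forall_inP=> x /=; rewrite !inE => xA; apply/forall_inP=> y.
  rewrite !inE => yA; apply/implyP=> ne_xy; suff : 0 < f [set x; y] by [].
  have fC u v : f [set u; v] = f [set v; u] by rewrite setUC.
  move: ne_xy; case/or3P: xA => /eqP->; case/or3P: yA => /eqP->; rewrite ?eqxx // => _;
    by rewrite ?f1 ?f2 ?f3 // fC ?f1 ?f2 ?f3.
- apply/eqP; rewrite /num_edges /= -sum_d (bigD1 [set a; b]) //= f1.
  rewrite (bigD1 [set b; c]) //= f2 (bigD1 [set a; c]) ?ne2 //= f3 big1 ?addn0 ?addnA //.
  by move=> e; rewrite /f -!andbA => /and3P[/negPf-> /negPf-> /negPf->].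
Qed.

Lemma ktriangles_of_tiles (ts : seq (trip T)) :
    uniq (vseq ts) -> all (mem (vertices M)) (vseq ts) -> all (tile (mu M) 5) ts ->
  exists Hs, [/\ tiling M Hs, size Hs = size ts, all (ktriangle 5) Hs
              & all (fun H => vertices H \subset [set x in vseq ts]) Hs].
Proof.
elim: ts => [|t ts IH]; first by exists [::].
rewrite -cat1s vseq_cat cat_uniq => /and3P[uniq_t disj uniq_ts].
rewrite [all (mem _) _]all_cat => /andP[t_M ts_M] /andP[t5 ts5].
have [Hs [/andP[sub_Hs disj_Hs] size_Hs Hs5 Hs_ts]] := IH uniq_ts ts_M ts5.
have [H [sub_H H5 DH]] := @ktriangle_of_tile 5 t isT uniq_t t_M t5.
exists (H :: Hs); split; rewrite ?[all (ktriangle 5) _]/= ?[size _]/= ?size_Hs ?H5 //.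
  apply/andP; split; first by apply/andP; split.
  rewrite /= disj_Hs andbT; apply: sub_all Hs_ts => H' sub_H'.
  rewrite /vertex_disjoint DH disjoint_sym; apply: disjointWl sub_H' _.
  apply/pred0P=> x /=; rewrite !in_set; apply/negP=> /andP[x_ts x_t].
  by case/negP: (hasPn disj x x_ts).
apply/andP; split.
  by rewrite DH; apply/subsetP=> x; rewrite !in_set => x_t; rewrite mem_cat x_t.
apply: sub_all Hs_ts => H' /subset_trans; apply.
by apply/subsetP=> x; rewrite !in_set => x_ts; rewrite mem_cat x_ts orbT.
Qed.

End Multigraphs.

Theorem theorem10 (T : finType) (M : multigraph T) (n : nat)
    (Mstd : standard M)
    (Mn : num_vertices M = n)
    (Mdeg : ((4%:R * n%:R - 3%:R) / 3%:R <= (min_deg M)%:R :> rat)%R) :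
  exists ts : seq (multigraph T),
    [/\ tiling M ts,
        size ts = n %/ 3
      & if ts is H :: ts' then ktriangle 4 H && all (ktriangle 5) ts'
        else true].
Proof.
have deg_ge x : x \in vertices M -> 4 * n <= 3 * (\sum_(y in vertices M) mu M x y) + 3.
  move=> /min_deg_le le_x; apply: leq_trans (_ : _ <= 3 * min_deg M + 3) _.
    rewrite -(ler_nat rat) natrD !natrM.
    by move: Mdeg; rewrite ler_pdivrMr ?ltr0n // lerBlDr (mulrC _ 3%:R)%R.
  by rewrite leq_add2r leq_mul2l.
(* The ambient type may be larger than the vertex set, hence the passage to the subtype. *)
have: packing (fun u v : {x in vertices M} => mu M (val u) (val v)) (n %/ 3).
  apply: packing_any => [u v|u|u v||u]; first exact: mu_sym.
  - exact: mu_xx.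
  - exact: Mstd.
  - by rewrite card_sig -Mn; apply: eq_card.
  by rewrite -(big_sub (vertices M) (mu M (val u))); apply/deg_ge/valP.
case=> [->|]; first by exists [::].
move=> [t [ts [uniq_ts t4 ts5 size_ts]]].
pose ts' := map (map_trip val) (t :: ts).
have ts'_M : all (mem (vertices M)) (vseq ts').
  by rewrite vseq_map all_map; apply/allP=> u _; apply: valP.
have uniq_ts' : uniq (vseq ts') by rewrite vseq_map map_inj_uniq //; apply: val_inj.
move: ts'_M uniq_ts'; rewrite /ts' map_cons -cat1s vseq_cat all_cat cat_uniq.
case/andP=> t_M ts_M /and3P[uniq_t disj uniq_us].
have [|Hs [/andP[sub_Hs disj_Hs] size_Hs Hs5 Hs_ts]] := ktriangles_of_tiles uniq_us ts_M.
  by rewrite all_map.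
have [H [sub_H H4 DH]] := @ktriangle_of_tile T M 4 _ isT uniq_t t_M t4.
exists (H :: Hs); split; last by rewrite H4.
  apply/andP; split; first by apply/andP; split.
  rewrite /= disj_Hs andbT; apply: sub_all Hs_ts => H' sub_H'.
  rewrite /vertex_disjoint DH disjoint_sym; apply: disjointWl sub_H' _.
  apply/pred0P=> x /=; rewrite !in_set; apply/negP=> /andP[x_ts x_t].
  by case/negP: (hasPn disj x x_ts).
by rewrite -size_ts /= size_Hs size_map.
Qed.
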